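(* Let $A \in \mathbb{R}^{m\times n}$ with $m \ge n$ have rank $n$, where $m$ is a power of $2$, and let $b \in \mathbb{R}^m$. Let $0<\varepsilon<1/3$, $0<\delta<1$, and $C\ge 1$ a constant. Let $\Theta$ be an $r\times m$ SRHT matrix with $r$ satisfying $$6C^2\varepsilon^{-1}\left[\sqrt{n} + \sqrt{8\ln(m/\delta)}\right]^2\ln(n/\delta) \le r \le m.$$ Let $x_{opt} = A^{+}b$ and $\tilde x_{opt} = (\Theta A)^{+}\Theta b$. Then, with probability at least $1 - \delta^{C^2\ln(n/\delta)/4} - 7\delta$, $$\|A\tilde x_{opt} - b\|_2 \le (1+22\varepsilon)\|A x_{opt} - b\|_2.$$ Furthermore, if $U_A \in \mathbb{R}^{m\times n}$ contains the left singular vectors of $A$ and there exists $\gamma\in(0,1]$ with $\|U_AU_A^T b\|_2 = \gamma\|b\|_2$, then with the same probability $$\|x_{opt} - \tilde x_{opt}\|_2 \le \left(\frac{1-\sqrt{\varepsilon}}{4\varepsilon}\right)^{1/2}\kappa(A)\sqrt{\gamma^{-2}-1}\;\|x_{opt}\|_2.$$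
   Context: Normalized Walsh–Hadamard matrix: for $N = 2^p$, $H_2 = \begin{pmatrix}1&1\\1&-1\end{pmatrix}$, $H_N = \begin{pmatrix} H_{N/2} & H_{N/2}\\ H_{N/2} & -H_{N/2}\end{pmatrix}$, and $H = N^{-1/2}H_N$. An $r\times N$ SRHT matrix ($N$ a power of 2) is $\Theta = \sqrt{N/r}\,RHD$ with $D$ an $N\times N$ diagonal matrix of independent uniform $\pm1$ signs, $H$ the normalized $N\times N$ Walsh–Hadamard matrix, and $R$ consisting of $r$ rows of $I_N$ chosen uniformly at random without replacement. $A^+$ is the Moore–Penrose pseudoinverse and $\kappa(A) = \|A\|_2\|A^+\|_2$ is the two-norm condition number. *)

(* Defs.v *)
From HB Require Import structures.
From mathcomp Require Export all_boot all_order all_algebra.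
From mathcomp Require Export boolp classical_sets reals sequences exp.

Set Implicit Arguments.
Unset Strict Implicit.
Unset Printing Implicit Defensive.

Import Order.TTheory GRing.Theory Num.Theory.
Local Open Scope ring_scope.

Section Norms.
Variable R : realType.

Definition norm2 (n : nat) (v : 'cV[R]_n) : R :=
  Num.sqrt (\sum_(i < n) v i 0 ^+ 2).

Definition specnorm (m n : nat) (A : 'M[R]_(m, n)) : R :=
  sup [set norm2 (A *m x) | x in [set x : 'cV[R]_n | norm2 x <= 1]]%classic.

(* The four Penrose equations. *)
Definition is_pseudoinverse (m n : nat) (A : 'M[R]_(m, n)) (X : 'M[R]_(n, m)) :
    Prop :=
  [/\ A *m X *m A = A, X *m A *m X = X,
      (A *m X)^T = A *m X & (X *m A)^T = X *m A].

(* The default value 0 of xget is never used: see pseudoinverseP.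
   (mathcomp's pinvmx is only a generalized inverse, not the Moore-Penrose
   one.) *)
Definition pseudoinverse (m n : nat) (A : 'M[R]_(m, n)) : 'M[R]_(n, m) :=
  xget 0 [set X | is_pseudoinverse A X]%classic.

Definition cond2 (m n : nat) (A : 'M[R]_(m, n)) : R :=
  specnorm A * specnorm (pseudoinverse A).

(* U is the left factor of a thin singular value decomposition
   A = U * diag(s) * V^T; the singular values may come in any order. *)
Definition left_singular_vectors (m n : nat) (A U : 'M[R]_(m, n)) : Prop :=
  exists (s : 'rV[R]_n) (V : 'M[R]_n),
    [/\ U^T *m U = 1%:M, V^T *m V = 1%:M, forall i, 0 <= s 0 i
      & A = U *m diag_mx s *m V^T].

Lemma gram_unit (m n : nat) (F : 'M[R]_(m, n)) :
  \rank F = n -> F^T *m F \in unitmx.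
Proof.
move=> rF; rewrite -row_free_unit -kermx_eq0; apply/eqP/row_matrixP => i.
rewrite row0; set u := row i _.
have hu : u *m (F^T *m F) = 0 by apply/sub_kermxP; exact: row_sub.
have huF : u *m F^T = 0.
  have h : (u *m F^T) *m (u *m F^T)^T = 0.
    by rewrite trmx_mul trmxK mulmxA -(mulmxA u) hu mul0mx.
  apply/rowP => j; rewrite [RHS]mxE.
  have := congr1 (fun M : 'M_1 => M 0 0) h; rewrite !mxE => /eqP.
  rewrite psumr_eq0; last first.
    by move=> k _; rewrite [_^T _ _]mxE -expr2 sqr_ge0.
  move=> /allP /(_ j); rewrite mem_index_enum => /(_ isT) /=.
  by rewrite [_^T _ _]mxE -expr2 sqrf_eq0 => /eqP; rewrite mxE.
have rfF : row_free F^T by rewrite /row_free mxrank_tr rF.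
by apply: (row_free_inj rfF); rewrite huF mul0mx.
Qed.

Lemma pseudoinverseP (m n : nat) (A : 'M[R]_(m, n)) :
  is_pseudoinverse A (pseudoinverse A).
Proof.
suff [X hX] : exists X, is_pseudoinverse A X.
  exact: (xgetPex 0 (ex_intro _ X hX)).
have [k [F [G [AE rF rG]]]] : exists k (F : 'M[R]_(m, k)) (G : 'M[R]_(k, n)),
    [/\ A = F *m G, \rank F = k & \rank G = k].
  exists (\rank A), (col_base A), (row_base A); split.
  - by rewrite mulmx_base.
  - by apply/eqP; exact: col_base_full.
  - by apply/eqP; exact: row_base_free.
have uF : F^T *m F \in unitmx by exact: gram_unit.
have uG : G *m G^T \in unitmx.
  by rewrite -{1}[G]trmxK; apply: gram_unit; rewrite mxrank_tr.
set P := invmx (F^T *m F); set Q := invmx (G *m G^T).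
have PT : P^T = P by rewrite /P trmx_inv trmx_mul trmxK.
have QT : Q^T = Q by rewrite /Q trmx_inv trmx_mul trmxK.
have AX : A *m (G^T *m Q *m P *m F^T) = F *m P *m F^T.
  rewrite AE -!mulmxA; congr (F *m _).
  by rewrite !mulmxA mulmxV // mul1mx.
have XA : (G^T *m Q *m P *m F^T) *m A = G^T *m Q *m G.
  by rewrite AE mulmxA -(mulmxA _ F^T F) -(mulmxA _ P) mulVmx // mulmx1.
exists (G^T *m Q *m P *m F^T); split.
- by rewrite AX AE mulmxA -(mulmxA _ F^T F) -(mulmxA _ P) mulVmx // mulmx1.
- rewrite XA !mulmxA -(mulmxA _ G) -(mulmxA (G^T *m Q)).
  by rewrite mulmxV // mulmx1.
- by rewrite AX !trmx_mul trmxK PT mulmxA.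
- by rewrite XA !trmx_mul trmxK QT mulmxA.
Qed.

Lemma pseudoinverse_uniq (m n : nat) (A : 'M[R]_(m, n)) X Y :
  is_pseudoinverse A X -> is_pseudoinverse A Y -> X = Y.
Proof.
move=> [x1 x2 x3 x4] [y1 y2 y3 y4].
have e1 : A *m X = A *m Y.
  by rewrite -{1}y1 -mulmxA -x3 -{1}y3 -trmx_mul mulmxA x1 y3.
have e2 : X *m A = Y *m A.
  rewrite -{1}y1 -mulmxA mulmxA -x4 -{1}y4 -trmx_mul.
  by rewrite -mulmxA (mulmxA A) x1 y4.
by rewrite -x2 e2 -mulmxA e1 mulmxA y2.
Qed.

End Norms.

Section SRHT.
Variable R : realType.

Lemma double_pow2 (p : nat) : (2 ^ p + 2 ^ p = 2 ^ p.+1)%N.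
Proof. by rewrite expnS mul2n addnn. Qed.

Fixpoint hadamard (p : nat) : 'M[R]_(2 ^ p) :=
  match p with
  | 0 => 1%:M
  | q.+1 => castmx (double_pow2 q, double_pow2 q)
      (block_mx (hadamard q) (hadamard q) (hadamard q) (- hadamard q))
  end.

Definition normalized_hadamard (p : nat) : 'M[R]_(2 ^ p) :=
  (Num.sqrt (2 ^ p)%:R)^-1 *: hadamard p.

(* An outcome (d, s): the sign of the j-th diagonal entry of D is (-1)^(d j),
   and the i-th row of the sampling matrix is row s i of the identity. *)
Definition srht_outcome (r N : nat) : Type :=
  ({ffun 'I_N -> bool} * {ffun 'I_r -> 'I_N})%type.

(* Sampling without replacement: s is injective. *)
Definition srht_space (r N : nat) : {set srht_outcome r N} :=
  [set w : srht_outcome r N | injectiveb w.2].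

(* Uniform probability on srht_space, so that the signs are independent and
   uniform, and independent of the uniformly chosen rows. *)
Definition srht_prob (r N : nat) (E : pred (srht_outcome r N)) : R :=
  #|[set w in srht_space r N | E w]|%:R / #|srht_space r N|%:R.

Definition sign_mx (N : nat) (d : {ffun 'I_N -> bool}) : 'M[R]_N :=
  diag_mx (\row_j (-1) ^+ d j).

Definition sampling_mx (r N : nat) (s : {ffun 'I_r -> 'I_N}) : 'M[R]_(r, N) :=
  rowsub s 1%:M.

Definition srht (r p : nat) (w : srht_outcome r (2 ^ p)) : 'M[R]_(r, 2 ^ p) :=
  Num.sqrt ((2 ^ p)%:R / r%:R) *:
    (sampling_mx w.2 *m normalized_hadamard p *m sign_mx w.1).

End SRHT.

(* Main.v *)
Require Import Defs.
From mathcomp Require Import all_boot all_order all_algebra perm.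
From mathcomp Require Import boolp classical_sets functions reals topology normedtype.
From mathcomp Require Import sequences exp spectral complex ring lra.

(** Let the columns of [W] be an orthonormal basis of the span of the columns of
[A] and [b], so that [W] has at most [n + 1] columns.  If [(Theta W)^T (Theta W)]
differs from the identity by at most [eta] as a quadratic form, then the normal
equations of both problems give
[|A (x~ - x)|^2 <= eta^2 / (1 - eta^2) |A x - b|^2], and both claims follow with
[eta^2 = 2 eps / 3].

The near-isometry holds outside an event of probability [5 delta].  For random
signs, the squared norm of a row of [H D W] has exponential moments of chi-square
type, as one sees by integrating out the signs one at a time; this
bounds all the rows simultaneously.  For such signs, the Gram matrix is a sum of
[r] rank-one matrices drawn without replacement, and its trace exponential is
controlled one draw at a time by the Golden--Thompson inequality for a
perturbation of rank one.  That inequality is proved for traces of powers, by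
comparing words in [A] and [v v^T] in a cone inside the nonnegative orthant of
the Lanczos basis of [v]. *)

Set Implicit Arguments.
Unset Strict Implicit.
Unset Printing Implicit Defensive.

Import Order.TTheory GRing.Theory Num.Theory.
Import numFieldNormedType.Exports.
Local Open Scope ring_scope.

(** * Rank-one perturbations of traces of powers *)

Section Dot.
Variable R : realFieldType.

(** Including [b] in the span of [W] lets one estimate control both the distortion of the range of
    [A] and the cross term between the error and the residual. The value of [eta] matches the sample
    size: the Chernoff exponent is [eta ^+ 2 * r / (4 * T)], with [T] a bound for the squared rows
    of the unnormalised [H D W], and [2 / 3 * 6 / 4 = 1] makes it at least [ln (n / delta)].

    Draws without replacement are dependent: once the Gram matrix [S] has been collected, the outer
    products still available sum to [tau - S], which involves the past. The rank-one inequality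
    suits this, since its right side uses only the eigensystem of the current matrix and is linear
    in [v v^T]. Averaging over the next vector therefore acts on each eigenvalue [l i] of [S]
    separately, where the available weights add up to the number [tau - l i]. *)

Definition dot n (u v : 'cV[R]_n) : R := \sum_i u i 0 * v i 0.

Definition psd n (A : 'M[R]_n) : Prop :=
  A^T = A /\ forall x, 0 <= dot x (A *m x).

Variable n : nat.
Implicit Types (u v w x : 'cV[R]_n) (A C : 'M[R]_n).

Lemma dotE u v : dot u v = (u^T *m v) 0 0.
Proof. by rewrite mxE; apply: eq_bigr => i _; rewrite mxE. Qed.

Lemma dotC u v : dot u v = dot v u.
Proof. by apply: eq_bigr => i _; rewrite mulrC. Qed.

Lemma dotDr u v w : dot u (v + w) = dot u v + dot u w.
Proof. by rewrite -big_split; apply: eq_bigr => i _; rewrite mxE mulrDr. Qed.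

Lemma dotDl u v w : dot (u + v) w = dot u w + dot v w.
Proof. by rewrite !(dotC _ w) dotDr. Qed.

Lemma dotZr a u v : dot u (a *: v) = a * dot u v.
Proof. by rewrite mulr_sumr; apply: eq_bigr => i _; rewrite mxE mulrCA. Qed.

Lemma dotZl a u v : dot (a *: u) v = a * dot u v.
Proof. by rewrite dotC dotZr dotC. Qed.

Lemma dotNr u v : dot u (- v) = - dot u v.
Proof. by rewrite -scaleN1r dotZr mulN1r. Qed.

Lemma dotNl u v : dot (- u) v = - dot u v.
Proof. by rewrite dotC dotNr dotC. Qed.

Lemma dotBr u v w : dot u (v - w) = dot u v - dot u w.
Proof. by rewrite dotDr dotNr. Qed.

Lemma dotBl u v w : dot (u - v) w = dot u w - dot v w.
Proof. by rewrite dotDl dotNl. Qed.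

Lemma dot0r u : dot u 0 = 0.
Proof. by rewrite -(scale0r 0) dotZr mul0r. Qed.

Lemma dot0l u : dot 0 u = 0.
Proof. by rewrite dotC dot0r. Qed.

Lemma dot_sumr I (r : seq I) (P : pred I) u (F : I -> 'cV[R]_n) :
  dot u (\sum_(i <- r | P i) F i) = \sum_(i <- r | P i) dot u (F i).
Proof. by apply: (big_morph (dot u)) => [v w|]; rewrite ?dotDr ?dot0r. Qed.

Lemma dot_ge0 u : 0 <= dot u u.
Proof. by apply: sumr_ge0 => i _; rewrite -expr2 sqr_ge0. Qed.

Lemma dot_eq0 u : dot u u = 0 -> u = 0.
Proof.
move=> /eqP; rewrite psumr_eq0 => [/allP h|i _]; last by rewrite -expr2 sqr_ge0.
apply/matrixP => i j; rewrite ord1 mxE; apply/eqP.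
by have /implyP := h i (mem_index_enum i); rewrite -expr2 sqrf_eq0; apply.
Qed.

Lemma dot_CauchySchwarz u v : dot u v ^+ 2 <= dot u u * dot v v.
Proof.
have [v0|vN0] := eqVneq (dot v v) 0.
  by rewrite (dot_eq0 v0) !dot0r expr0n mulr0.
have vp : 0 < dot v v by rewrite lt_neqAle eq_sym vN0 dot_ge0.
rewrite -(ler_pM2l vp).
have := dot_ge0 (dot v v *: u - dot u v *: v).
rewrite !(dotBl, dotBr, dotZl, dotZr) (dotC v u) => h; rewrite -subr_ge0.
by apply: le_trans h _; rewrite le_eqVlt; apply/orP; left; apply/eqP; ring.
Qed.

Lemma mul_outer v u : (v *m v^T) *m u = dot v u *: v.
Proof.
rewrite -mulmxA; apply/matrixP => i j; rewrite ord1 !mxE big_ord1 mulrC dotE.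
by [].
Qed.

Lemma mxtrace_outer A v : \tr (A *m (v *m v^T)) = dot v (A *m v).
Proof.
by rewrite mulmxA mxtrace_mulC dotE /mxtrace big_ord1.
Qed.

Lemma trmx_outer v : (v *m v^T)^T = v *m v^T.
Proof. by rewrite trmx_mul trmxK. Qed.

End Dot.

Lemma dot_mulmx_tr (R : realFieldType) n m (B : 'M[R]_(n, m)) y x :
  dot x (B *m y) = dot (B^T *m x) y.
Proof. by rewrite !dotE trmx_mul trmxK mulmxA. Qed.

(** * A cone of Krylov vectors preserved by [C] and [v v^T] *)

Section Cone.
Variables (R : realFieldType) (n : nat) (v : 'cV[R]_n) (C : 'M[R]_n).
Hypothesis psdC : psd C.

(** [Q] is [dot v v] times the orthogonal projection onto the complement of [v]; without
    normalisation nothing is divided by and [v = 0] is allowed. *)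
Let Q : 'M[R]_n := (dot v v)%:M - v *m v^T.
Let y k : 'cV[R]_n := (Q *m C) ^+ k *m v.

(* In the Lanczos basis of [v] this cone lies in the nonnegative orthant, on
   which [C], [Q] and [v v^T] act by entrywise nonnegative matrices. *)
Inductive lanczos_cone : 'cV[R]_n -> Prop :=
| lanczos_cone0 : lanczos_cone 0
| lanczos_coneD c k w : 0 <= c -> lanczos_cone w -> lanczos_cone (w + c *: y k).

Local Notation K := lanczos_cone.

Lemma cone_gen c k : 0 <= c -> K (c *: y k).
Proof. by move=> c0; rewrite -[_ *: _]add0r; apply: lanczos_coneD => //; constructor. Qed.

Lemma cone_add w w' : K w -> K w' -> K (w + w').
Proof.
move=> Kw; elim => [|c k w'' c0 _ IH]; first by rewrite addr0.
by rewrite addrA; apply: lanczos_coneD.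
Qed.

Lemma cone_scale a w : 0 <= a -> K w -> K (a *: w).
Proof.
move=> a0; elim => [|c k w' c0 _ IH]; first by rewrite scaler0; constructor.
by rewrite scalerDr scalerA; apply: lanczos_coneD => //; apply: mulr_ge0.
Qed.

Lemma cone_linear (M : 'M[R]_n) :
  (forall k, K (M *m y k)) -> forall w, K w -> K (M *m w).
Proof.
move=> h w; elim => [|c k w' c0 _ IH]; first by rewrite mulmx0; constructor.
by rewrite mulmxDr -scalemxAr; apply: cone_add => //; apply: cone_scale.
Qed.

Lemma lanczos0 : y 0 = v.
Proof. by rewrite /y expr0 mul1mx. Qed.

Lemma lanczosS k : y k.+1 = Q *m (C *m y k).
Proof. by rewrite /y exprS -!mulmxA. Qed.

Lemma mul_proj_compl w : Q *m w = dot v v *: w - dot v w *: v.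
Proof. by rewrite mulmxBl mul_scalar_mx mul_outer. Qed.

Lemma tr_proj_compl : Q^T = Q.
Proof. by rewrite linearB /= tr_scalar_mx trmx_outer. Qed.

Lemma dot_lanczosS k : dot v (y k.+1) = 0.
Proof. by rewrite lanczosS mul_proj_compl dotBr !dotZr mulrC subrr. Qed.

Lemma psd_proj_compl : psd Q.
Proof.
split; first exact: tr_proj_compl.
move=> x; rewrite mul_proj_compl dotBr !dotZr (dotC x v) -expr2 subr_ge0.
exact: dot_CauchySchwarz.
Qed.

(** Both [C] and [Q] are symmetric, so a factor [Q *m C] moves across the product: these numbers
    form a Hankel matrix. *)
Lemma dot_lanczos_shift i j : dot (C *m y i) (y j) = dot v (C *m y (i + j)).
Proof.
elim: i j => [|i IH] j.
  by rewrite lanczos0 add0n dot_mulmx_tr (proj1 psdC).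
rewrite addSnnS -IH !lanczosS (dotC _ (y j)) dot_mulmx_tr (proj1 psdC).
by rewrite dot_mulmx_tr tr_proj_compl dotC.
Qed.

(** Halving [k] by the Hankel property gives a square: for even [k] the form of [C] at [y (k / 2)],
    for odd [k] the form of [Q] at [C *m y h], where [k = 2 h + 1]. *)
Lemma dot_lanczos_ge0 k : 0 <= dot v (C *m y k).
Proof.
rewrite -(odd_double_half k) -addnn; case: (odd k) => /=; last first.
  by rewrite add0n -dot_lanczos_shift dotC; apply: (proj2 psdC).
rewrite add1n -addnS -dot_lanczos_shift lanczosS; exact: (proj2 psd_proj_compl).
Qed.

Lemma cone_base : K v.
Proof. by rewrite -lanczos0 -[y 0]scale1r; apply: cone_gen. Qed.

Lemma cone_proj_compl w : K w -> K (Q *m w).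
Proof.
apply: cone_linear => -[|k]; rewrite mul_proj_compl.
  by rewrite lanczos0 subrr; constructor.
by rewrite dot_lanczosS scale0r subr0; apply: cone_gen; apply: dot_ge0.
Qed.

Lemma dot_cone_ge0 w : K w -> 0 <= dot v w.
Proof.
elim => [|c [|k] w' c0 _ IH]; rewrite ?dot0r // dotDr dotZr addr_ge0 //.
  by rewrite lanczos0 mulr_ge0 // dot_ge0.
by rewrite dot_lanczosS mulr0.
Qed.

Lemma cone_outer w : K w -> K ((v *m v^T) *m w).
Proof.
by move=> Kw; rewrite mul_outer; apply: cone_scale; [exact: dot_cone_ge0|exact: cone_base].
Qed.

Lemma cone_psd w : K w -> K (C *m w).
Proof.
apply: cone_linear => k.
have [v0|vN0] := eqVneq (dot v v) 0.
  have {}v0 := dot_eq0 v0.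
  by rewrite /y v0 !mulmx0; constructor.
(* Since [Q + v v^T] is [dot v v] times the identity, [C *m y k] splits into a multiple of [y k.+1]
   and a multiple of [v = y 0]. *)
have -> : C *m y k = (dot v v)^-1 *: y k.+1
    + ((dot v v)^-1 * dot v (C *m y k)) *: y 0.
  by rewrite lanczosS mul_proj_compl lanczos0 -scalerA -scalerDr subrK scalerA mulVf // scale1r.
have vi : 0 <= (dot v v)^-1 by rewrite invr_ge0 dot_ge0.
apply: cone_add; apply: cone_gen => //.
by apply: mulr_ge0 => //; apply: dot_lanczos_ge0.
Qed.

Definition cone_map (M : 'M[R]_n) := forall w, K w -> K (M *m w).

Lemma cone_mapD M N : cone_map M -> cone_map N -> cone_map (M + N).
Proof. by move=> hM hN w Kw; rewrite mulmxDl; apply: cone_add; auto. Qed.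

Lemma cone_mapZ a M : 0 <= a -> cone_map M -> cone_map (a *: M).
Proof. by move=> a0 hM w Kw; rewrite -scalemxAl; apply: cone_scale; auto. Qed.

Lemma cone_map_scalar a : 0 <= a -> cone_map a%:M.
Proof. by move=> a0 w Kw; rewrite mul_scalar_mx; apply: cone_scale. Qed.

Lemma cone_mapX M k : cone_map M -> cone_map (M ^+ k).
Proof.
move=> hM; elim: k => [|k IH] w Kw; first by rewrite expr0 mul1mx.
by rewrite exprS -mulmxA; apply: hM; apply: IH.
Qed.

(** The difference is the sum of the words in [M] and [N] that contain [N], and every such word
    preserves the cone. *)
Lemma cone_map_exprB M N i :
  cone_map M -> cone_map N -> forall w, K w -> K ((M + N) ^+ i *m w - M ^+ i *m w).
Proof.
move=> hM hN w Kw; elim: i => [|i IH]; first by rewrite !expr0 subrr; constructor.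
have hMN := cone_mapD hM hN.
rewrite !exprS -[(M + N) * _]/((M + N) *m _) -[M * _]/(M *m _) -!mulmxA.
rewrite mulmxDl addrAC -mulmxBr; apply: cone_add; first exact: hM.
by apply: hN; apply: (cone_mapX i hMN).
Qed.

Lemma outer_compl (b : R) :
  b%:M - v *m v^T = (b - dot v v)%:M + Q.
Proof. by rewrite /Q raddfB /= addrA subrK. Qed.

Lemma cone_outer_compl b : dot v v <= b -> cone_map (b%:M - v *m v^T).
Proof.
move=> hb; rewrite outer_compl; apply: cone_mapD; last exact: cone_proj_compl.
by apply: cone_map_scalar; rewrite subr_ge0.
Qed.

End Cone.

(** * Term-by-term comparison of powers *)

Section TracePower.
Variables (R : realFieldType) (n : nat).
Implicit Types (A C : 'M[R]_n) (v : 'cV[R]_n).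

(** Telescoping without commutation; cyclicity of the trace then brings the isolated factor [X] to
    the end. *)
Lemma trace_exprB (A X : 'M[R]_n) k :
  \tr ((A + X) ^+ k) - \tr (A ^+ k)
    = \sum_(i < k) \tr (A ^+ (k.-1 - i) *m (A + X) ^+ i *m X).
Proof.
suff h : (A + X) ^+ k - A ^+ k
    = \sum_(i < k) (A + X) ^+ i *m X *m A ^+ (k.-1 - i).
  rewrite -linearB /= h raddf_sum /=; apply: eq_bigr => i _.
  by rewrite mxtrace_mulC mulmxA.
elim: k => [|k IH]; first by rewrite big_ord0 !expr0 subrr.
rewrite big_ord_recl /= subn0 expr0 mul1mx.
have -> : \sum_(i < k) (A + X) ^+ (bump 0 i) *m X *m A ^+ (k - bump 0 i)
    = (A + X) *m \sum_(i < k) (A + X) ^+ i *m X *m A ^+ (k.-1 - i).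
  rewrite mulmx_sumr; apply: eq_bigr => i _; rewrite !mulmxA /bump /= add1n.
  by rewrite exprS -[k.-1]subn1 -subnDA add1n.
rewrite -IH mulmxBr !exprS -[(A + X) * _]/((A + X) *m _) -[A * _]/(A *m _).
by rewrite [X in _ = _ + (_ - X)]mulmxDl opprD !addrA [X *m _ + _]addrC addrAC addrK.
Qed.

(** The same telescoping for a scalar shift, with the exponents arranged as in [trace_exprB] so that
    the two sums match index by index. *)
Lemma dot_exprB A v b k :
  dot v ((A + b%:M) ^+ k *m v) - dot v (A ^+ k *m v)
    = b * \sum_(i < k) dot v (A ^+ (k.-1 - i) *m ((A + b%:M) ^+ i *m v)).
Proof.
have cm : GRing.comm A (A + b%:M).
  apply: commrD => //; exact: scalar_mxC.
rewrite -dotBr -mulmxBl -[_ - _]opprB -[A ^+ k - _]/(A ^+ k - _).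
rewrite (subrXX_comm k cm) opprD addrA subrr add0r mulNr opprK.
rewrite -[_ * \sum_(_ < _) _]/(_ *m \sum_(_ < _) _).
rewrite mul_scalar_mx -scalemxAl dotZr; congr (_ * _).
rewrite mulmx_suml dot_sumr; apply: eq_bigr => i _.
by rewrite mulmxA.
Qed.

(* Each side is a sum of terms [v^T A^j B^i v]; they are compared one by one
   in the cone. *)
Lemma trace_expr_rank1_le A v (th b : R) k :
  dot v v <= b -> 0 < b -> psd A -> psd (A + (th * b)%:M) ->
  \tr ((A + th *: (v *m v^T)) ^+ k) <= \tr (A ^+ k)
    + b^-1 * (dot v ((A + (th * b)%:M) ^+ k *m v) - dot v (A ^+ k *m v)).
Proof.
move=> hv b0 pA pC.
rewrite dot_exprB -lerBlDl trace_exprB.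
rewrite mulrA [b^-1 * _]mulrCA mulVf ?gt_eqF // mulr1 mulr_sumr.
apply: ler_sum => i _.
rewrite -scalemxAr mxtraceZ mxtrace_outer -mulmxA.
set B := A + th *: _; set C := A + _%:M.
rewrite -subr_ge0 -mulrBr -dotBr -mulmxBr.
set j := (_ - i)%N.
(* Here [C - B = th (b - v v^T)]. The cone must come from the smaller of [A] and [C], so that all
   other matrices arise from it by adding cone maps: from [A] when [th >= 0], from [C] when
   [th < 0]. This is why both are assumed positive semidefinite. *)
have [th0|th0] := leP 0 th.
- apply: mulr_ge0 => //; apply: (dot_cone_ge0 (C := A)).
  apply: (cone_mapX j); first by move=> w; exact: cone_psd.
  have -> : C = B + th *: (b%:M - v *m v^T).
    by rewrite /B /C scalerBr -addrA [_ *: _ + (_ - _)]addrC subrK scale_scalar_mx.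
  apply: (cone_map_exprB (M := B)); last exact: cone_base.
    apply: cone_mapD; first by move=> w; exact: cone_psd.
    by apply: cone_mapZ => // w; exact: cone_outer.
  by apply: cone_mapZ => //; exact: cone_outer_compl.
- apply: mulr_le0; first exact: ltW.
  rewrite -oppr_ge0 -dotNr -mulmxN opprB; apply: (dot_cone_ge0 (C := C)).
  have nth0 : 0 <= - th by rewrite oppr_ge0 ltW.
  apply: (cone_mapX j).
    have -> : A = C + (- th * b)%:M by rewrite /C mulNr raddfN /= addrK.
    apply: cone_mapD; first by move=> w; exact: cone_psd.
    by apply: cone_map_scalar; rewrite mulr_ge0 // ltW.
  have -> : B = C + (- th) *: (b%:M - v *m v^T).
    by rewrite /B /C scalerBr !scaleNr opprK scale_scalar_mx addrA addrK.
  apply: (cone_map_exprB (M := C)); last exact: cone_base.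
    by move=> w; exact: cone_psd.
  by apply: cone_mapZ => //; exact: cone_outer_compl.
Qed.

End TracePower.

(** * Eigenvectors of real symmetric matrices *)

Section Spectral.
Variables (R : rcfType) (n : nat).

(* Real and imaginary parts of a unitary eigenbasis: [a i + i b i] is a unit
   eigenvector for the eigenvalue [l i]. *)
Definition eigensystem (A : 'M[R]_n) (l : 'I_n -> R) (a b : 'I_n -> 'cV[R]_n) :=
  [/\ forall i, A *m a i = l i *: a i, forall i, A *m b i = l i *: b i,
      \sum_i (a i *m (a i)^T + b i *m (b i)^T) = 1%:M
    & forall i, dot (a i) (a i) + dot (b i) (b i) = 1].

(** The spectral theorem is applied over the complex numbers. As [A] and its eigenvalues are real,
    the real and imaginary parts of an eigenvector each satisfy the eigenvalue equation, one of them
    possibly being zero. *)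
Lemma symmetric_eigensystem (A : 'M[R]_n) :
  A^T = A -> exists l a b, eigensystem A l a b.
Proof.
move=> symA; pose Ac : 'M[R[i]]_n := map_mx (real_complex R) A.
have hA : Ac \is hermsymmx.
  apply: realsym_hermsym.
    apply/is_hermitianmxP.
    by rewrite expr0 scale1r map_mx_id // /Ac map_trmx symA.
  by apply/mxOverP => i j; rewrite mxE complex_real.
have hsp := hermitian_spectral_diag_real hA.
have /hermitian_normalmx /orthomx_spectralP A_eq := hA.
have Pu := spectral_unitarymx Ac.
have Pi := spectral_unit Ac.
set P := spectralmx Ac in A_eq Pu Pi.
set s := spectral_diag Ac in A_eq hsp.
have PA : P *m Ac = diag_mx s *m P by rewrite A_eq !mulmxA mulmxV // mul1mx.
have sR i : s 0 i = (complex.Re (s 0 i))%:C%C.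
  by rewrite RRe_real //; move/mxOverP: hsp; apply.
have cE (z : R[i]) : Num.conj z = ((complex.Re z) -i* (complex.Im z))%C by case: z.
have P1 := unitarymxP Pu.
have P2 := mulmx1C P1.
pose a i : 'cV[R]_n := \col_j complex.Re (P i j).
pose b i : 'cV[R]_n := \col_j complex.Im (P i j).
have ReD : {morph (@complex.Re R) : x y / x + y} by case=> ? ? [].
have ImD : {morph (@complex.Im R) : x y / x + y} by case=> ? ? [].
have hPA i k : \sum_j P i j * (A j k)%:C%C = s 0 i * P i k.
  have := congr1 (fun M : 'M_n => M i k) PA; rewrite mul_diag_mx !mxE => <-.
  by apply: eq_bigr => j _; rewrite mxE.
exists (fun i => complex.Re (s 0 i)), a, b; split.
- move=> i; apply/matrixP => k z; rewrite ord1 !mxE {z}.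
  have := congr1 (@complex.Re R) (hPA i k).
  rewrite (big_morph _ ReD (erefl _)) sR /=; case: (P i k) => x y /=.
  rewrite mul0r subr0 => <-; apply: eq_bigr => j _; rewrite mxE.
  by rewrite -[in A k j]symA mxE; case: (P i j) => u v /=; rewrite mulr0 subr0 mulrC.
- move=> i; apply/matrixP => k z; rewrite ord1 !mxE {z}.
  have := congr1 (@complex.Im R) (hPA i k).
  rewrite (big_morph _ ImD (erefl _)) sR /=; case: (P i k) => x y /=.
  rewrite mul0r addr0 => <-; apply: eq_bigr => j _; rewrite mxE.
  by rewrite -[in A k j]symA mxE; case: (P i j) => u v /=; rewrite mulr0 add0r mulrC.
- apply/matrixP => j k; rewrite summxE.
  have := congr1 (fun M : 'M_n => complex.Re (M j k)) P2; rewrite !mxE.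
  rewrite (big_morph _ ReD (erefl _)) => h.
  transitivity (complex.Re ((j == k)%:R : R[i])); last by case: (j == k).
  rewrite -h; apply: eq_bigr => i _; rewrite !mxE !big_ord1 !mxE cE.
  by case: (P i j) => x y; case: (P i k) => u v /=; ring.
- move=> i; have := congr1 (fun M : 'M_n => complex.Re (M i i)) P1; rewrite !mxE eqxx.
  rewrite (big_morph _ ReD (erefl _)) /= => <-.
  rewrite -big_split; apply: eq_bigr => j _; rewrite !mxE cE.
  by case: (P i j) => x y /=; ring.
Qed.

End Spectral.

(** * The Golden--Thompson inequality for rank-one perturbations *)

Section Eigensystem.
Variables (R : realType) (n : nat) (A : 'M[R]_n).
Variables (l : 'I_n -> R) (a b : 'I_n -> 'cV[R]_n).
Hypothesis hA : eigensystem A l a b.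

(** Squared modulus of the complex inner product of [v] with the unit eigenvector. *)
Definition eigweight (a b : 'I_n -> 'cV[R]_n) i (v : 'cV[R]_n) : R :=
  dot (a i) v ^+ 2 + dot (b i) v ^+ 2.

Lemma eigweight_ge0 i v : 0 <= eigweight a b i v.
Proof. by rewrite addr_ge0 ?sqr_ge0. Qed.

Lemma eigensystem_expr k :
  A ^+ k = \sum_i l i ^+ k *: (a i *m (a i)^T + b i *m (b i)^T).
Proof.
case: hA => ha hb h1 _; elim: k => [|k IH].
  by rewrite expr0 -[LHS]h1; apply: eq_bigr => i _; rewrite expr0 scale1r.
rewrite exprS IH -[A * _]/(A *m _) mulmx_sumr; apply: eq_bigr => i _.
rewrite -scalemxAr mulmxDr !mulmxA ha hb -!scalemxAl -scalerDr scalerA.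
by rewrite -exprSr.
Qed.

Lemma dot_expr_eigen k v : dot v (A ^+ k *m v) = \sum_i l i ^+ k * eigweight a b i v.
Proof.
rewrite eigensystem_expr mulmx_suml dot_sumr; apply: eq_bigr => i _.
rewrite -scalemxAl dotZr mulmxDl !mul_outer dotDr !dotZr.
by rewrite !(dotC v) -!expr2.
Qed.

Lemma dot_eigen v : dot v (A *m v) = \sum_i l i * eigweight a b i v.
Proof. exact: (dot_expr_eigen 1). Qed.

Lemma eigweight_sum v : \sum_i eigweight a b i v = dot v v.
Proof.
have := dot_expr_eigen 0 v; rewrite expr0 mul1mx => ->.
by apply: eq_bigr => i _; rewrite expr0 mul1r.
Qed.

Lemma trace_expr_eigen k : \tr (A ^+ k) = \sum_i l i ^+ k.
Proof.
case: hA => ha hb h1 h2.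
rewrite eigensystem_expr raddf_sum; apply: eq_bigr => i _ /=.
rewrite mxtraceZ mxtraceD.
by rewrite -[a i *m _]mul1mx -[b i *m _]mul1mx !mxtrace_outer !mul1mx h2 mulr1.
Qed.

Lemma eigensystem_affine c e :
  eigensystem (c *: A + e%:M) (fun i => c * l i + e) a b.
Proof.
case: hA => ha hb h1 h2; split => // i;
  by rewrite mulmxDl mul_scalar_mx -scalemxAl ?ha ?hb scalerA -scalerDl.
Qed.

Lemma eigenvalue_dot i : l i = dot (a i) (A *m a i) + dot (b i) (A *m b i).
Proof. by case: hA => ha hb _ h2; rewrite ha hb !dotZr -mulrDr h2 mulr1. Qed.

Lemma psd_eigen : A^T = A -> (forall i, 0 <= l i) -> psd A.
Proof.
move=> symA l0; split => // x; rewrite dot_eigen; apply: sumr_ge0 => i _.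
by rewrite mulr_ge0 // eigweight_ge0.
Qed.

End Eigensystem.

(** * From powers to exponentials *)

Section TraceExp.
Variable R : realType.

Lemma cvg_expR (x : R) : (series (exp_coeff x) @ \oo --> expR x)%classic.
Proof. exact: is_cvg_series_exp_coeff. Qed.

Lemma cvg_expR_comb (I : finType) (c x : I -> R) :
  ((fun N => \sum_i c i * series (exp_coeff (x i)) N) @ \oo
    --> \sum_i c i * expR (x i))%classic.
Proof.
apply: cvg_big => [|i _]; first exact: add_continuous.
by apply: cvgMl_tmp; exact: cvg_expR.
Qed.

Lemma sum_series_exp (I : finType) (c x : I -> R) N :
  \sum_i c i * series (exp_coeff (x i)) N
    = \sum_(0 <= k < N) (\sum_i c i * x i ^+ k) / k`!%:R.
Proof.
under eq_bigr do rewrite /series /= mulr_sumr.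
rewrite exchange_big /=; apply: eq_bigr => k _; rewrite mulr_suml.
by apply: eq_bigr => i _; rewrite /exp_coeff /= mulrA.
Qed.

Variables (n : nat).
Implicit Types (A : 'M[R]_n) (v : 'cV[R]_n).

(** The inequality for powers is divided by the factorial of [k] and summed. Eigensystems turn both
    sides into scalar exponential series, so no matrix exponential is needed. *)
Lemma trace_exp_rank1_psd A v (th beta : R) l a b l' a' b' :
  dot v v <= beta -> 0 < beta -> psd A -> psd (A + (th * beta)%:M) ->
  eigensystem A l a b -> eigensystem (A + th *: (v *m v^T)) l' a' b' ->
  \sum_i expR (l' i) <= \sum_i expR (l i)
    + beta^-1 * \sum_i eigweight a b i v * (expR (l i + th * beta) - expR (l i)).
Proof.
move=> hv b0 pA pC hA hA'.
have hC : eigensystem (A + (th * beta)%:M) (fun i => l i + th * beta) a b.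
  have := eigensystem_affine hA 1 (th * beta); rewrite scale1r.
  by under eq_fun do rewrite mul1r.
have -> : \sum_i expR (l' i) = \sum_i 1 * expR (l' i).
  by apply: eq_bigr => i _; rewrite mul1r.
have -> : \sum_i expR (l i) + beta^-1 * \sum_i eigweight a b i v *
      (expR (l i + th * beta) - expR (l i))
    = \sum_i (1 - beta^-1 * eigweight a b i v) * expR (l i) +
      \sum_i (beta^-1 * eigweight a b i v) * expR (l i + th * beta).
  by rewrite mulr_sumr -!big_split; apply: eq_bigr => i _ /=; ring.
have c1 := @cvg_expR_comb _ (fun=> 1) l'.
have c2 := @cvg_expR_comb _ (fun i => 1 - beta^-1 * eigweight a b i v) l.
have c3 := @cvg_expR_comb _ (fun i => beta^-1 * eigweight a b i v)
  (fun i => l i + th * beta).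
apply: (ler_cvg_to c1 (cvgD c2 c3)); near=> N.
rewrite fctE !sum_series_exp -big_split.
apply: ler_sum => k _ /=; rewrite -mulrDl ler_wpM2r ?invr_ge0 //.
have := trace_expr_rank1_le k hv b0 pA pC.
rewrite (trace_expr_eigen hA') (trace_expr_eigen hA).
rewrite (dot_expr_eigen hA) (dot_expr_eigen hC) => h.
rewrite (eq_bigr (fun i => l' i ^+ k)) => [|i _]; last by rewrite mul1r.
apply: le_trans h _; rewrite le_eqVlt; apply/orP; left; apply/eqP.
rewrite -sumrB mulr_sumr -!big_split; apply: eq_bigr => i _ /=; ring.
Unshelve. all: by end_near. Qed.

(** Adding [c] times the identity multiplies every exponential by [expR c]: a large [c] secures
    positivity, and the factor cancels at the end. *)
Lemma trace_exp_rank1 A v (th beta : R) l a b l' a' b' :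
  A^T = A -> dot v v <= beta -> 0 < beta ->
  eigensystem A l a b -> eigensystem (A + th *: (v *m v^T)) l' a' b' ->
  \sum_i expR (l' i) <= \sum_i expR (l i) * (1 + (expR (th * beta) - 1) / beta
    * eigweight a b i v).
Proof.
move=> symA hv b0 hA hA'.
pose c := \sum_i `|l i| + `|th * beta|.
have lc i : `|l i| <= \sum_i `|l i|.
  by rewrite (bigD1 i) //= lerDl; apply: sumr_ge0.
have shift B m (p q : 'I_n -> 'cV[R]_n) : eigensystem B m p q ->
    eigensystem (B + c%:M) (fun i => m i + c) p q.
  move=> h; have := eigensystem_affine h 1 c; rewrite scale1r.
  by under eq_fun do rewrite mul1r.
have symc (e : R) : (A + e%:M)^T = A + e%:M.
  by rewrite linearD /= symA tr_scalar_mx.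
have pA : psd (A + c%:M).
  apply: (psd_eigen (shift _ _ _ _ hA)) => // i.
  have := lc i; rewrite /c; have := normr_ge0 (th * beta).
  have := ler_norm (- l i); rewrite normrN; lra.
have pC : psd (A + c%:M + (th * beta)%:M).
  rewrite -addrA -raddfD /=.
  have hC := eigensystem_affine hA 1 (c + th * beta).
  rewrite scale1r in hC.
  apply: (psd_eigen hC) => // i; rewrite mul1r.
  have := lc i; rewrite /c; have := ler_norm (- (th * beta)).
  have := ler_norm (- l i); rewrite !normrN; lra.
have hA'c : eigensystem (A + c%:M + th *: (v *m v^T)) (fun i => l' i + c) a' b'.
  by rewrite addrAC; exact: shift.
have := trace_exp_rank1_psd hv b0 pA pC (shift _ _ _ _ hA) hA'c.
rewrite mulr_sumr -big_split /=.
under eq_bigr do rewrite expRD.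
under [X in _ <= X -> _]eq_bigr => i _.
  rewrite [l i + c + _]addrAC !(expRD _ c) (expRD (l i) (th * beta)).
  rewrite (_ : _ + _ = expR (l i) * (1 + (expR (th * beta) - 1) / beta
    * eigweight a b i v) * expR c); last by ring.
  over.
by rewrite -!mulr_suml ler_pM2r // expR_gt0.
Qed.

(** Odd terms of the two series cancel, and even ones compare by [2 ^ k * k! <= (2 k)!]. *)
Lemma expR_cosh (c : R) : expR c + expR (- c) <= 2 * expR (c ^+ 2 / 2).
Proof.
have cv : ((fun N => 2 * series (exp_coeff (c ^+ 2 / 2)) N) @ \oo -->
    2 * expR (c ^+ 2 / 2))%classic by apply: cvgMl_tmp; exact: cvg_expR.
apply: (ler_cvg_to (cvgD (@cvg_expR c) (@cvg_expR (- c))) cv); near=> N.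
rewrite fctE /series /= -big_split /=.
pose f k : R := exp_coeff c k + exp_coeff (- c) k.
have f_even k : f k.*2 = 2 * (c ^+ k.*2 / k.*2`!%:R).
  by rewrite /f /exp_coeff /= exprNn -signr_odd odd_double expr0 mul1r; lra.
have f_odd k : f k.*2.+1 = 0.
  by rewrite /f /exp_coeff /= exprNn -signr_odd /= odd_double expr1 mulN1r mulNr subrr.
have f_ge0 k : 0 <= f k.
  rewrite -(odd_double_half k); case: (odd k); rewrite ?add1n ?f_odd ?add0n //.
  by rewrite f_even mulr_ge0 // divr_ge0 // exprn_even_ge0 // odd_double.
rewrite -[leLHS]/(\sum_(0 <= k < N) f k).
(* Nonnegative terms are added on the left to reach [N.*2] of them, so that each consecutive pair
   faces one term on the right. *)
apply: (@le_trans _ _ (\sum_(0 <= k < N.*2) f k)).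
  have NN : (N <= N.*2)%N by rewrite -addnn leq_addr.
  by rewrite (@big_cat_nat _ _ _ N 0%N N.*2) //= lerDl sumr_ge0.
have factd k : (2 ^ k * k`! <= k.*2`!)%N.
  elim: k => // k IH; rewrite doubleS !factS expnS.
  apply: leq_trans (_ : k.*2.+2 * (2 ^ k * k`!) <= _)%N.
    by rewrite -doubleS -mul2n !mulnA [(2 * _ * _)%N]mulnAC.
  by rewrite leq_mul2l /=; apply: leq_trans IH _; rewrite leq_pmull.
elim: (N : nat) => [|k IH]; first by rewrite !big_nil mulr0.
rewrite doubleS !big_nat_recr //= f_odd addr0 mulrDr lerD // f_even.
rewrite ler_wpM2l // /exp_coeff /= expr_div_n -exprM mul2n -mulrA.
rewrite ler_wpM2l //; first by rewrite exprn_even_ge0 // odd_double.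
rewrite -invfM -natrX -natrM lef_pV2 ?posrE ?ltr0n ?muln_gt0 ?fact_gt0 ?expn_gt0 //.
by rewrite ler_nat.
Unshelve. all: by end_near. Qed.

End TraceExp.

(** * Sampling without replacement *)

Section TrExp.
Variables (R : realType) (n : nat).
Implicit Types (A S : 'M[R]_n) (v : 'cV[R]_n).

(** A symmetric matrix has an eigensystem, so the default [0] is never taken for one. *)
Definition eigval A : 'I_n -> R :=
  xget (fun=> 0) [set l | exists a b, eigensystem A l a b]%classic.

Definition trexp A : R := \sum_i expR (eigval A i).

Lemma eigvalP A : A^T = A -> exists a b, eigensystem A (eigval A) a b.
Proof.
move=> /symmetric_eigensystem[l [a [b h]]].
apply: (@xgetPex _ (fun=> 0) [set l | exists a b, eigensystem A l a b]%classic).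
by exists l, a, b.
Qed.

(** The rank-one inequality with zero perturbation compares two eigensystems of one matrix; used in
    both directions it makes [trexp] independent of the choice. *)
Lemma sum_expR_eigen A l a b l' a' b' : A^T = A ->
  eigensystem A l a b -> eigensystem A l' a' b' ->
  \sum_i expR (l i) <= \sum_i expR (l' i).
Proof.
move=> symA hA hA'.
have h0 : eigensystem (A + 0 *: (0 *m (0 : 'cV[R]_n)^T)) l a b.
  by rewrite scale0r addr0.
have d0 : dot (0 : 'cV[R]_n) 0 <= 1 by rewrite dot0r.
apply: le_trans (trace_exp_rank1 symA d0 ltr01 hA' h0) _.
by apply: ler_sum => i _; rewrite mul0r expR0 subrr mul0r mul0r addr0 mulr1.
Qed.

Lemma trexpE A l a b : A^T = A -> eigensystem A l a b ->
  trexp A = \sum_i expR (l i).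
Proof.
move=> symA hA; have [a' [b' hA']] := eigvalP symA.
by apply/eqP; rewrite eq_le /trexp (sum_expR_eigen symA hA' hA) (sum_expR_eigen symA hA hA').
Qed.

Lemma trexp_ge0 A : 0 <= trexp A.
Proof. by apply: sumr_ge0 => i _; apply: expR_ge0. Qed.

Lemma trexpZ A l a b th : A^T = A -> eigensystem A l a b ->
  trexp (th *: A) = \sum_i expR (th * l i).
Proof.
move=> symA hA; have hth := eigensystem_affine hA th 0.
rewrite raddf0 addr0 in hth.
rewrite (trexpE _ hth); last by rewrite linearZ /= symA.
by apply: eq_bigr => i _; rewrite addr0.
Qed.

Lemma trexp0 : trexp 0 = n%:R.
Proof.
have [l [a [b h]]] : exists l a b, eigensystem (0 : 'M[R]_n) l a b.
  by apply: symmetric_eigensystem; rewrite trmx0.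
rewrite (trexpE _ h) ?trmx0 // (eq_bigr (fun=> 1)) => [|i _].
  by rewrite sumr_const card_ord.
by rewrite (eigenvalue_dot h) !mul0mx !dot0r addr0 expR0.
Qed.

(** The exponential of one eigenvalue is at most the whole trace, so the hypothesis bounds every
    eigenvalue by [s]. *)
Lemma trexp_dot_le A (th s : R) (x : 'cV[R]_n) : A^T = A -> 0 < th ->
  trexp (th *: A) <= expR (th * s) -> dot x (A *m x) <= s * dot x x.
Proof.
move=> symA th0; have [l [a [b hA]]] := symmetric_eigensystem symA.
rewrite (trexpZ th symA hA) => h.
rewrite (dot_eigen hA) -(eigweight_sum hA) mulr_sumr.
apply: ler_sum => i _; apply: ler_wpM2r; first exact: eigweight_ge0.
rewrite -(ler_pM2l th0) -ler_expR; apply: le_trans h.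
by rewrite (bigD1 i) //= lerDl; apply: sumr_ge0 => j _; apply: expR_ge0.
Qed.

End TrExp.

(** Two tangent inequalities at [a * x], towards [x] and towards [0]; with weights [a] and [1 - a]
    their linear terms cancel. *)
Lemma expR_convex0 (R : realType) (a x : R) : 0 <= a <= 1 ->
  expR (a * x) - 1 <= a * (expR x - 1).
Proof.
move=> /andP[a0 a1].
have h1 := expR_ge1Dx ((1 - a) * x).
have h2 := expR_ge1Dx (- (a * x)).
have e0 := expR_gt0 (a * x).
have eN : expR (a * x) * expR (- (a * x)) = 1 by rewrite expRxMexpNx_1.
have eD : expR (a * x) * expR ((1 - a) * x) = expR x.
  by rewrite -expRD; congr expR; ring.
set E := expR (a * x) in e0 eN eD *.
have : E * (a * expR ((1 - a) * x) + (1 - a) * expR (- (a * x))) >= E * 1.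
  rewrite ler_pM2l //.
  have := ler_wpM2l a0 h1; have a1' : 0 <= 1 - a by lra.
  have := ler_wpM2l a1' h2; lra.
have -> : E * (a * expR ((1 - a) * x) + (1 - a) * expR (- (a * x)))
    = a * (E * expR ((1 - a) * x)) + (1 - a) * (E * expR (- (a * x))) by ring.
rewrite eN eD; lra.
Qed.

(** * Trace exponentials of sums drawn without replacement *)

Section Sampling.
Variables (R : realType) (m d : nat) (v : 'I_m -> 'cV[R]_d) (beta tau : R).
Hypotheses (beta0 : 0 < beta) (vbeta : forall j, dot (v j) (v j) <= beta).
Hypotheses (tau0 : 0 <= tau) (vtau : \sum_j v j *m (v j)^T = tau%:M).

(** Slope of the chord of [x |-> expR (th * x)] over the interval from [0] to [beta]. *)
Definition chernoff_rate (beta th : R) : R := (expR (th * beta) - 1) / beta.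
Local Notation q := (chernoff_rate beta).

Lemma chernoff_rate_ge th : th <= q th.
Proof. by rewrite ler_pdivlMr //; have := expR_ge1Dx (th * beta); lra. Qed.

Lemma chernoff_rate_convex a th : 0 <= a <= 1 -> q (a * th) <= a * q th.
Proof.
move=> ha; rewrite /q mulrA ler_pM2r ?invr_gt0 // -mulrA.
exact: expR_convex0.
Qed.

(** The available weights at an eigenvector of [S] sum to [tau - l i]. The part [- l i], with
    [t <= q t], lowers the rate from [a] to [a * (1 - #|J|^-1)]; the part [tau], with
    [q (a * th) <= a * q th], gives the scalar exponential factor. *)
Lemma sum_trexp_draw (J : {set 'I_m}) (S : 'M[R]_d) (th a : R) :
  (0 < #|J|)%N -> psd S -> \sum_(j in J) v j *m (v j)^T = tau%:M - S ->
  0 <= a <= 1 ->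
  \sum_(j in J) trexp ((a * th) *: (S + v j *m (v j)^T))
    <= #|J|%:R * (trexp ((a * (1 - #|J|%:R^-1) * th) *: S)
        * expR (q th * tau * (a * #|J|%:R^-1))).
Proof.
move=> J0 [symS pS] hJ ha; set M : R := #|J|%:R.
have M0 : 0 < M by rewrite ltr0n.
have [l [x [y hS]]] := symmetric_eigensystem symS.
have l0 i : 0 <= l i.
  by rewrite (eigenvalue_dot hS) addr_ge0.
set t := a * th.
have ht := eigensystem_affine hS t 0; rewrite raddf0 addr0 in ht.
have symt : (t *: S)^T = t *: S by rewrite linearZ /= symS.
apply: (@le_trans _ _ (\sum_(j in J) \sum_i expR (t * l i) *
    (1 + q t * eigweight x y i (v j)))).
  apply: ler_sum => j _; rewrite scalerDr.
  have symtj : (t *: S + t *: (v j *m (v j)^T))^T = t *: S + t *: (v j *m (v j)^T).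
    by rewrite linearD /= symt linearZ /= trmx_outer.
  have [l' [x' [y' h']]] := symmetric_eigensystem symtj.
  rewrite (trexpE symtj h').
  apply: le_trans (trace_exp_rank1 symt (vbeta j) beta0 ht h') _.
  by apply: ler_sum => i _; rewrite addr0.
rewrite exchange_big /= (trexpZ _ symS hS) mulr_suml mulr_sumr.
apply: ler_sum => i _; rewrite -mulr_sumr big_split /= sumr_const -mulr_sumr.
have -> : \sum_(j in J) eigweight x y i (v j) = tau - l i.
  transitivity (dot (x i) ((\sum_(j in J) v j *m (v j)^T) *m x i)
      + dot (y i) ((\sum_(j in J) v j *m (v j)^T) *m y i)).
    rewrite !mulmx_suml !dot_sumr -big_split; apply: eq_bigr => j _ /=.
    by rewrite !mul_outer !dotZr /eigweight !expr2 !(dotC (v j)).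
  rewrite hJ !mulmxBl !mul_scalar_mx !dotBr !dotZr (eigenvalue_dot hS i).
  by case: hS => _ _ _ /(_ i) h; rewrite -[tau in RHS]mulr1 -h; ring.
rewrite -[_ *+ _]/M.
have -> : expR (t * l i) * (M + q t * (tau - l i))
    = M * (expR (t * l i) * (1 + q t * (tau - l i) / M)).
  by field; rewrite gt_eqF.
rewrite ler_pM2l //.
apply: (@le_trans _ _ (expR (t * l i) * expR (q t * (tau - l i) / M))).
  by rewrite ler_pM2l ?expR_gt0 // expR_ge1Dx.
rewrite -!expRD ler_expR.
have qt := chernoff_rate_ge t; have qc := chernoff_rate_convex th ha; rewrite -/t in qc.
have h1 : t * (l i / M) <= q t * (l i / M).
  by apply: ler_wpM2r qt; rewrite divr_ge0 // ltW.
have h2 : q t * (tau / M) <= a * q th * (tau / M).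
  by apply: ler_wpM2r qc; rewrite divr_ge0 // ltW.
have -> : a * (1 - M^-1) * th * l i = t * l i - t * (l i / M) by rewrite /t; ring.
lra.
Qed.

Variable r : nat.
Hypothesis rm : (r <= m)%N.
Local Notation sample := {ffun 'I_r -> 'I_m}.
Implicit Types (s : sample) (k : nat).

Definition past k s : {set 'I_m} := [set s i | i : 'I_r & (i < k)%N].

Definition partial_gram k s : 'M[R]_d :=
  \sum_(i < r | (i < k)%N) v (s i) *m (v (s i))^T.

Lemma psd_partial_gram k s : psd (partial_gram k s).
Proof.
split.
  by rewrite linear_sum /=; apply: eq_bigr => i _; rewrite trmx_outer.
move=> x; rewrite mulmx_suml dot_sumr; apply: sumr_ge0 => i _.
by rewrite mul_outer dotZr (dotC x) -expr2 sqr_ge0.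
Qed.

Lemma card_past k s : injectiveb s -> (k <= r)%N -> #|past k s| = k.
Proof.
move=> /injectiveP injs kr; rewrite card_imset //.
rewrite -sum1_card (eq_bigl (fun i : 'I_r => (i < k)%N)) => [|i]; last by rewrite inE.
by rewrite -(big_ord_widen r (fun=> 1%N)) // sum1_card card_ord.
Qed.

Lemma sum_future k s : injectiveb s ->
  \sum_(j in ~: past k s) v j *m (v j)^T = tau%:M - partial_gram k s.
Proof.
move=> /injectiveP injs; rewrite -vtau.
have -> : partial_gram k s = \sum_(j in past k s) v j *m (v j)^T.
  rewrite big_imset /=; last by move=> ? ? _ _; exact: injs.
  by apply: eq_bigl => i; rewrite inE.
rewrite [X in _ = X - _](bigID (mem (past k s))) /= [RHS]addrC addKr.
by apply: eq_bigl => i; rewrite inE.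
Qed.

(* The involution showing that, given the past, the value drawn at time [k] is
   uniform among those still available. *)
Definition swap (k : 'I_r) (x : sample * 'I_m) : sample * 'I_m :=
  ([ffun i => tperm (x.1 k) x.2 (x.1 i)], x.1 k).

Lemma swapK (k : 'I_r) : involutive (swap k).
Proof.
move=> [s j]; rewrite /swap /= ffunE tpermL; congr (_, _).
by apply/ffunP => i; rewrite !ffunE tpermC tpermK.
Qed.

Lemma swap_past (k : 'I_r) s j (i : 'I_r) :
  injectiveb s -> j \notin past k s -> (i < k)%N ->
  (swap k (s, j)).1 i = s i.
Proof.
move=> /injectiveP injs jP ik; rewrite /swap /= ffunE tpermD //.
  by apply/eqP => /injs e; rewrite e ltnn in ik.
by apply: contraNneq jP => ->; apply: imset_f; rewrite inE.
Qed.

Lemma past_swap (k : 'I_r) s j : injectiveb s -> j \notin past k s ->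
  past k (swap k (s, j)).1 = past k s.
Proof.
move=> injs jP; apply/setP => z; apply/imsetP/imsetP => -[i0]; rewrite inE => ik ->;
  by exists i0; rewrite ?inE // swap_past.
Qed.

Lemma swap_valid (k : 'I_r) x :
  (injectiveb (swap k x).1 && ((swap k x).2 \notin past k (swap k x).1))
    = (injectiveb x.1 && (x.2 \notin past k x.1)).
Proof.
have h (y : sample * 'I_m) : injectiveb y.1 && (y.2 \notin past k y.1) ->
    injectiveb (swap k y).1 && ((swap k y).2 \notin past k (swap k y).1).
  case: y => s j /= /andP[injs jP]; rewrite past_swap //.
  move/injectiveP: (injs) => Is.
  apply/andP; split.
    apply/injectiveP => i i'; rewrite !ffunE => /perm_inj; exact: Is.
  apply/imsetP => -[i0]; rewrite inE => ik /Is e.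
  by rewrite e ltnn in ik.
by apply/idP/idP => [/h|/h //]; rewrite swapK.
Qed.

(** The factor [m - k] counts the values still available; reindexing by the involution [swap k]
    turns the spare value into the one drawn at time [k]. *)
Lemma sum_next_draw (k : 'I_r) (G : sample -> R) :
  \sum_(s : sample | injectiveb s) (m - k)%:R * G s
    = \sum_(s : sample | injectiveb s) \sum_(j in ~: past k s) G (swap k (s, j)).1.
Proof.
transitivity (\sum_(s : sample | injectiveb s) \sum_(j in ~: past k s) G s).
  apply: eq_bigr => s injs; rewrite sumr_const cardsCs finset.setCK card_past //; last exact: ltnW.
  by rewrite card_ord mulr_natl.
rewrite !pair_big_dep /= (reindex_inj (inv_inj (@swapK k))) /=.
apply: eq_bigl => -[s j]; have := swap_valid k (s, j).
by rewrite !inE.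
Qed.

Lemma partial_gram_swap (k : 'I_r) s j : injectiveb s -> j \notin past k s ->
  partial_gram k.+1 (swap k (s, j)).1 = partial_gram k s + v j *m (v j)^T.
Proof.
move=> injs jP; rewrite /partial_gram (bigD1 k) ?ltnS //= addrC; congr (_ + _); last first.
  by rewrite ffunE tpermL.
rewrite (eq_bigl (fun i : 'I_r => (i < k)%N)) => [|i]; last first.
  by rewrite ltnS -val_eqE /= ltn_neqAle andbC.
by apply: eq_bigr => i ik; rewrite swap_past.
Qed.

(* [a (m - k) = m - r] is the self-correction of sampling without replacement:
   it keeps the total rate equal to that of independent draws. *)
Lemma sum_trexp_sample th k : (k <= r)%N -> exists2 a : R, 0 <= a <= 1 &
  a * (m - k)%:R = (m - r)%:R /\
  \sum_(s : sample | injectiveb s) trexp (th *: partial_gram r s)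
    <= expR (q th * tau * (1 - a)) *
       \sum_(s : sample | injectiveb s) trexp ((a * th) *: partial_gram k s).
Proof.
move=> kr; rewrite -(subKn kr); move: (leq_subr k r); set t := (r - k)%N; move: t.
elim => [|t IH] tr.
  exists 1; first by rewrite ler01 lexx.
  by rewrite subn0 !mul1r subrr mulr0 expR0 mul1r.
have [a /andP[a0 a1] [ha IHs]] := IH (ltnW tr).
have k_lt : (r - t.+1 < r)%N by rewrite subnSK // leq_subr.
pose K := Ordinal k_lt.
have rtK : (r - t = K.+1)%N by rewrite /= subnSK.
rewrite rtK in ha IHs; rewrite -[(r - t.+1)%N]/(K : nat).
have Km : (K < m)%N by apply: leq_trans rm.
have M0 : 0 < (m - K)%:R :> R by rewrite ltr0n subn_gt0.
have M1 : 1 <= (m - K)%:R :> R by rewrite ler1n subn_gt0.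
set M : R := (m - K)%:R in M0 M1 *.
have Mi : 0 <= M^-1 <= 1 by rewrite invr_ge0 ltW //= invf_le1.
have MS : (m - K.+1)%:R = M - 1.
  by rewrite /M -[in RHS](subnSK Km) -natr1 addrK.
(* Since [M * (1 - M^-1) = M - 1], the invariant passes from [K.+1] back to [K]; the lost share
   [a * M^-1] goes into the exponential factor. *)
exists (a * (1 - M^-1)).
  by apply/andP; split; [apply: mulr_ge0 => //; lra | nra].
split.
  by rewrite -ha MS; field; rewrite gt_eqF.
apply: le_trans IHs _.
have -> : expR (q th * tau * (1 - a * (1 - M^-1)))
   = expR (q th * tau * (1 - a)) * expR (q th * tau * (a * M^-1)).
  by rewrite -expRD; congr expR; ring.
rewrite -[leRHS]mulrA ler_pM2l ?expR_gt0 // -(ler_pM2l M0) !mulr_sumr.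
rewrite sum_next_draw; apply: ler_sum => s injs.
have cJ : #|~: past K s| = (m - K)%N.
  by rewrite cardsCs finset.setCK card_past ?card_ord // ltnW.
have J0 : (0 < #|~: past K s|)%N by rewrite cJ subn_gt0.
have a01 : 0 <= a <= 1 by rewrite a0.
have := sum_trexp_draw th J0 (psd_partial_gram K s) (sum_future K injs) a01.
rewrite cJ -/M => h; rewrite [expR _ * _]mulrC; apply: le_trans h.
rewrite le_eqVlt; apply/orP; left; apply/eqP; apply: eq_bigr => j.
by rewrite inE => jP; rewrite partial_gram_swap.
Qed.

Definition gram s : 'M[R]_d := \sum_i v (s i) *m (v (s i))^T.

Lemma sum_trexp_gram th : (0 < m)%N ->
  \sum_(s : sample | injectiveb s) trexp (th *: gram s)
    <= #|[set s : sample | injectiveb s]|%:R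
       * (d%:R * expR (q th * (tau * (r%:R / m%:R)))).
Proof.
move=> m0; have [a a01 [ha h]] := sum_trexp_sample th (leq0n r).
have aE : 1 - a = r%:R / m%:R.
  have mR : m%:R != 0 :> R by rewrite pnatr_eq0 -lt0n.
  apply: (mulIf mR); rewrite divfK // mulrBl mul1r.
  by move: ha; rewrite subn0 => ->; rewrite natrB // subKr.
rewrite (eq_bigr (fun s : sample => trexp (th *: partial_gram r s))) => [|s _]; last first.
  congr (trexp (_ *: _)); apply: eq_bigl => i; by rewrite ltn_ord.
apply: le_trans h _; rewrite (eq_bigr (fun=> d%:R)) => [|s _]; last first.
  by rewrite /partial_gram big_pred0 // scaler0 trexp0.
rewrite sumr_const aE cardsE -[q th * _ * _]mulrA -mulr_natl.
by rewrite le_eqVlt; apply/orP; left; apply/eqP; ring.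
Qed.

End Sampling.

(** The tangent bound at [- (x / 2)], squared, gives [expR x <= (1 - x / 2) ^- 2]. The remaining
    polynomial inequality needs [1 - 3 * x + x ^+ 2 >= 0], which the bound on [x] ensures. *)
Lemma expR_quadratic (R : realType) (x : R) : `|x| <= 1 / 4 ->
  expR x <= 1 + x + x ^+ 2.
Proof.
rewrite ler_norml => /andP[x1 x2].
have h := expR_ge1Dx (- (x / 2)).
have p : 0 < 1 - x / 2 by lra.
have e : expR x * expR (- (x / 2)) ^+ 2 = 1.
  by rewrite expr2 -!expRD -[RHS]expR0; congr expR; field.
have {}h : (1 - x / 2) ^+ 2 <= expR (- (x / 2)) ^+ 2.
  by rewrite ler_sqr ?nnegrE ?expR_ge0 // ltW.
have p2 : 0 < (1 - x / 2) ^+ 2 by rewrite exprn_gt0.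
rewrite -(ler_pM2r p2); apply: (@le_trans _ _ 1).
  by rewrite -[leRHS]e ler_pM2l ?expR_gt0.
have -> : (1 + x + x ^+ 2) * (1 - x / 2) ^+ 2
    = 1 + x ^+ 2 / 4 * (1 - 3 * x + x ^+ 2) by field.
rewrite lerDl mulr_ge0 //; first by rewrite divr_ge0 // sqr_ge0.
nra.
Qed.

(** * The two-sided Chernoff bound *)

Section Chernoff.
Variables (R : realType) (m d r : nat) (v : 'I_m -> 'cV[R]_d) (beta tau : R).
Hypotheses (beta0 : 0 < beta) (vbeta : forall j, dot (v j) (v j) <= beta).
Hypotheses (tau0 : 0 <= tau) (vtau : \sum_j v j *m (v j)^T = tau%:M).
Hypotheses (rm : (r <= m)%N) (m0 : (0 < m)%N) (mean1 : tau * (r%:R / m%:R) = 1).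
Variable eta : R.
Hypothesis eta01 : 0 < eta <= 1 / 2.

Definition near_isometry (eta : R) (S : 'M[R]_d) : Prop :=
  forall x, `|dot x (S *m x) - dot x x| <= eta * dot x x.

Lemma trexp_near_isometry (S : 'M[R]_d) : S^T = S ->
  let th := eta / 2 / beta in
  trexp (th *: S) <= expR (th * (1 + eta)) ->
  trexp ((- th) *: S) <= expR (- th * (1 - eta)) ->
  near_isometry eta S.
Proof.
move=> symS th h1 h2 x; have [eta0 eta1] := andP eta01.
have th0 : 0 < th by rewrite !divr_gt0 //; lra.
have u := trexp_dot_le x symS th0 h1.
have symN : (- S)^T = - S by rewrite linearN /= symS.
have h2' : trexp (th *: (- S)) <= expR (th * (- (1 - eta))).
  by rewrite scalerN -scaleNr mulrN -mulNr.
have w := trexp_dot_le x symN th0 h2'; rewrite mulNmx dotNr in w.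
by rewrite ler_norml; lra.
Qed.

Lemma trmx_gram (s : {ffun 'I_r -> 'I_m}) : (gram v s)^T = gram v s.
Proof. by rewrite linear_sum /=; apply: eq_bigr => i _; rewrite trmx_outer. Qed.

Lemma card_not_near_isometry :
  #|[set s : {ffun 'I_r -> 'I_m} | injectiveb s & ~~ `[< near_isometry eta (gram v s) >]]|%:R
    <= #|[set s : {ffun 'I_r -> 'I_m} | injectiveb s]|%:R
       * (2 * d%:R * expR (- (eta ^+ 2 / (4 * beta)))).
Proof.
(* [th = eta / (2 * beta)] minimises [th ^+ 2 * beta - th * eta], the exponent left by
   [expR_quadratic]. Then [th * beta = eta / 2 <= 1 / 4], as that lemma requires. *)
have [eta0 eta1] := andP eta01; set th := eta / 2 / beta.
have th0 : 0 < th by rewrite !divr_gt0 //; lra.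
(* Markov's inequality for both tails at once: [f s < 1] forces the near-isometry. *)
pose f (s : {ffun 'I_r -> 'I_m}) : R :=
  expR (- (th * (1 + eta))) * trexp (th *: gram v s)
  + expR (th * (1 - eta)) * trexp ((- th) *: gram v s).
apply: (@le_trans _ _ (\sum_(s : {ffun 'I_r -> 'I_m} | injectiveb s) f s)).
  rewrite -sum1_card natr_sum big_mkcond [leRHS]big_mkcond /=.
  apply: ler_sum => s _; rewrite inE; case: ifP => [/andP[-> hs]|_]; last first.
    by case: ifP => // _; rewrite /f addr_ge0 // mulr_ge0 ?expR_ge0 ?trexp_ge0.
  rewrite leNgt; apply: contra hs => hf; apply/asboolP.
  have p1 : 0 <= expR (- (th * (1 + eta))) * trexp (th *: gram v s).
    by rewrite mulr_ge0 ?expR_ge0 ?trexp_ge0.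
  have p2 : 0 <= expR (th * (1 - eta)) * trexp (- th *: gram v s).
    by rewrite mulr_ge0 ?expR_ge0 ?trexp_ge0.
  apply: trexp_near_isometry; first exact: trmx_gram.
    rewrite -(ler_pM2l (expR_gt0 (- (th * (1 + eta))))) -expRD addNr expR0.
    by apply: ltW; apply: le_lt_trans hf; rewrite /f lerDl.
  rewrite -(ler_pM2l (expR_gt0 (th * (1 - eta)))) mulNr -expRD addrN expR0.
  by apply: ltW; apply: le_lt_trans hf; rewrite /f lerDr.
rewrite big_split /= -!mulr_sumr.
set c := #|_|%:R.
have b1 := sum_trexp_gram beta0 vbeta tau0 vtau rm th m0.
have b2 := sum_trexp_gram beta0 vbeta tau0 vtau rm (- th) m0.
rewrite mean1 mulr1 -/c in b1; rewrite mean1 mulr1 -/c in b2.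
have key (y z : R) : `|y * beta| <= 1 / 4 ->
    ((y * beta) + (y * beta) ^+ 2) / beta + z = - (eta ^+ 2 / (4 * beta)) ->
    expR z * (c * (d%:R * expR (chernoff_rate beta y)))
      <= c * (d%:R * expR (- (eta ^+ 2 / (4 * beta)))).
  move=> hy e.
  have -> : expR z * (c * (d%:R * expR (chernoff_rate beta y)))
      = c * (d%:R * (expR (chernoff_rate beta y) * expR z)) by ring.
  rewrite ler_wpM2l // ler_wpM2l // -expRD ler_expR -e lerD2r.
  rewrite /chernoff_rate ler_pM2r ?invr_gt0 //.
  have := expR_quadratic hy; lra.
have thb : th * beta = eta / 2 by rewrite /th divfK // gt_eqF.
have k1 := key th (- (th * (1 + eta))).
have k2 := key (- th) (th * (1 - eta)).
have e4 : `|eta / 2| <= 1 / 4 by rewrite ger0_norm; lra.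
rewrite mulNr normrN thb in k2; rewrite thb in k1.
have bn : beta != 0 by rewrite gt_eqF.
have {}k1 := k1 e4; have {}k2 := k2 e4.
have {}k1 : expR (- (th * (1 + eta))) * (c * (d%:R * expR (chernoff_rate beta th)))
    <= c * (d%:R * expR (- (eta ^+ 2 / (4 * beta)))).
  by apply: k1; rewrite /th; field.
have {}k2 : expR (th * (1 - eta)) * (c * (d%:R * expR (chernoff_rate beta (- th))))
    <= c * (d%:R * expR (- (eta ^+ 2 / (4 * beta)))).
  by apply: k2; rewrite /th; field.
have m1 := ler_wpM2l (expR_ge0 (- (th * (1 + eta)))) b1.
have m2 := ler_wpM2l (expR_ge0 (th * (1 - eta))) b2.
apply: le_trans (lerD (le_trans m1 k1) (le_trans m2 k2)) _.
by rewrite le_eqVlt; apply/orP; left; apply/eqP; ring.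
Qed.

End Chernoff.

(** * Rademacher sums *)

Section PosDef.
Variables (R : realType) (d : nat).
Implicit Types (B : 'M[R]_d) (x y : 'cV[R]_d).

Definition coercive (w : R) B : Prop :=
  B^T = B /\ forall x, w * dot x x <= dot x (B *m x).

Lemma coercive_unit w B : 0 < w -> coercive w B -> B \in unitmx.
Proof.
move=> w0 [symB hB]; rewrite -row_free_unit; apply: inj_row_free => u hu.
have hx : B *m u^T = 0 by rewrite -{1}symB -trmx_mul hu trmx0.
have := hB u^T; rewrite hx dot0r pmulr_rle0 // => h.
have /dot_eq0 : dot u^T u^T = 0 by apply/eqP; rewrite eq_le h dot_ge0.
by move/(congr1 trmx); rewrite trmxK trmx0.
Qed.

Lemma dot_invmx_le w B x : 0 < w -> coercive w B ->
  dot x (invmx B *m x) <= dot x x / w.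
Proof.
move=> w0 hB; have uB := coercive_unit w0 hB; set z := invmx B *m x.
have Bz : B *m z = x by rewrite mulKVmx.
have h := proj2 hB z; rewrite Bz dotC in h.
have := dot_ge0 (w *: z - x).
rewrite !(dotBl, dotBr, dotZl, dotZr) (dotC z x) => h2.
rewrite ler_pdivlMr //.
have h3 := ler_wpM2l (ltW w0) h.
lra.
Qed.

(* [dot y (invmx B y)] is the maximum over [x] of [2 x.y - x.Bx]. *)
Lemma dot_invmx_rank1 w B a y : 0 < w -> coercive w B ->
  dot y (invmx (B + a *m a^T) *m y) + dot a (invmx (B + a *m a^T) *m y) ^+ 2
    <= dot y (invmx B *m y).
Proof.
move=> w0 hB; have uB := coercive_unit w0 hB.
have hC : coercive w (B + a *m a^T).
  split; first by rewrite linearD /= (proj1 hB) trmx_outer.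
  move=> x; rewrite mulmxDl dotDr mul_outer dotZr (dotC x a) -expr2.
  by apply: le_trans (proj2 hB x) _; rewrite lerDl sqr_ge0.
have uC := coercive_unit w0 hC.
set x := invmx _ *m y; set z := invmx B *m y.
have Bz : B *m z = y by rewrite mulKVmx.
have Cx : B *m x + dot a x *: a = y.
  by rewrite -mul_outer -mulmxDl mulKVmx.
have h := proj2 hB (z - x).
have h0 : 0 <= w * dot (z - x) (z - x) by rewrite mulr_ge0 ?dot_ge0 // ltW.
have {h0 h} := le_trans h0 h.
have Bx : B *m x = y - dot a x *: a by rewrite -Cx addrK.
rewrite mulmxBr Bz Bx !(dotBl, dotBr, dotZl, dotZr).
have zBx : dot z (B *m x) = dot y x.
  by rewrite dot_mulmx_tr (proj1 hB) Bz.
rewrite Bx dotBr dotZr in zBx.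
rewrite !(dotC x y) !(dotC z y) !(dotC x a) in zBx *; nra.
Qed.

End PosDef.

Section Flip.
Variables (R : realType) (N : nat).

Definition flip (k : 'I_N) (e : {ffun 'I_N -> bool}) : {ffun 'I_N -> bool} :=
  [ffun i => (i == k) (+) e i].

Lemma flipK k : involutive (flip k).
Proof. by move=> e; apply/ffunP => i; rewrite !ffunE addbA addbb. Qed.

(** Integrating out the sign at [k]: the involution [flip k] pairs the sign vectors. *)
Lemma sum_flip_le k (F G : {ffun 'I_N -> bool} -> R) :
  (forall e, F e + F (flip k e) <= 2 * G e) -> \sum_e F e <= \sum_e G e.
Proof.
move=> h; suff : 2 * \sum_e F e <= 2 * \sum_e G e by lra.
have -> : 2 * \sum_e F e = \sum_e (F e + F (flip k e)).
  have e : \sum_e F e = \sum_e F (flip k e).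
    by rewrite [LHS](reindex_inj (inv_inj (flipK k))).
  by rewrite big_split /= -e; ring.
by rewrite mulr_sumr; apply: ler_sum.
Qed.

End Flip.

(** * Exponential moments of the squared norm *)

Section Rademacher.
Variables (R : realType) (N d : nat) (a : 'I_N -> 'cV[R]_d).
Hypothesis a1 : \sum_i a i *m (a i)^T = 1%:M.
Variable mu : R.
Hypothesis mu01 : 0 < mu < 1.
Implicit Types (e : {ffun 'I_N -> bool}) (k : nat).

(** With this shift the last matrix [B N] is [w + 1 = mu^-1] times the identity, so the final
    potential is [expR] of [mu / 2] times the squared norm. *)
Let w : R := mu^-1 - 1.

Let w0 : 0 < w.
Proof. by case/andP: mu01 => m0 m1; rewrite subr_gt0 invf_gt1. Qed.

Let B k : 'M[R]_d := w%:M + \sum_(i < N | (i < k)%N) a i *m (a i)^T.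

Definition partial_sum k e : 'cV[R]_d := \sum_(i < N | (i < k)%N) (-1) ^+ e i *: a i.

Lemma coercive_shifted_gram k : coercive w (B k).
Proof.
split.
  rewrite linearD /= tr_scalar_mx linear_sum /=; congr (_ + _).
  by apply: eq_bigr => i _; rewrite trmx_outer.
move=> x; rewrite mulmxDl mul_scalar_mx dotDr dotZr lerDl mulmx_suml dot_sumr.
by apply: sumr_ge0 => i _; rewrite mul_outer dotZr (dotC x) -expr2 sqr_ge0.
Qed.

Lemma shifted_gramS (k : 'I_N) : B k.+1 = B k + a k *m (a k)^T.
Proof.
rewrite /B (bigD1 k) ?ltnS //= -addrA; congr (_ + _); rewrite addrC; congr (_ + _).
by apply: eq_bigl => i; rewrite ltnS -val_eqE /= ltn_neqAle andbC.
Qed.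

Lemma partial_sum_S (k : 'I_N) e :
  partial_sum k.+1 e = partial_sum k e + (-1) ^+ e k *: a k.
Proof.
rewrite /partial_sum (bigD1 k) ?ltnS //= addrC; congr (_ + _).
by apply: eq_bigl => i; rewrite ltnS -val_eqE /= ltn_neqAle andbC.
Qed.

Lemma partial_sum_flip (k : 'I_N) e : partial_sum k (flip k e) = partial_sum k e.
Proof.
apply: eq_bigr => i ik; rewrite ffunE -val_eqE /= ltn_eqF //.
Qed.

Lemma flip_at (k : 'I_N) e : flip k e k = ~~ e k.
Proof. by rewrite ffunE eqxx. Qed.

Let phi k e : R := expR (dot (partial_sum k e) (invmx (B k) *m partial_sum k e) / 2).

(** Averaging over the sign leaves the hyperbolic cosine of [c = dot (a k) (Q *m y)], at most
    [expR (c ^+ 2 / 2)]. Passing from [B k] to [B k.+1] lowers the form at [y] by at least [c ^+ 2],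
    which pays for it; only [dot (a k) (Q *m a k)] is left over. *)
Lemma rademacher_potential_step (k : 'I_N) e :
  phi k.+1 e + phi k.+1 (flip k e)
    <= 2 * (expR (dot (a k) (a k) / w / 2) * phi k e).
Proof.
rewrite /phi !partial_sum_S partial_sum_flip flip_at.
set y := partial_sum k e; set Q := invmx (B k.+1).
have symQ : Q^T = Q by rewrite /Q trmx_inv (proj1 (coercive_shifted_gram _)).
have expand (s : bool) : dot (y + (-1) ^+ s *: a k) (Q *m (y + (-1) ^+ s *: a k))
    = dot y (Q *m y) + dot (a k) (Q *m a k) + 2 * ((-1) ^+ s * dot (a k) (Q *m y)).
  rewrite mulmxDr -scalemxAr !(dotDl, dotDr, dotZl, dotZr).
  have -> : dot y (Q *m a k) = dot (a k) (Q *m y).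
    by rewrite dot_mulmx_tr symQ dotC.
  have : ((-1) ^+ s) ^+ 2 = 1 :> R by rewrite sqrr_sign.
  by move: ((-1) ^+ s) => z hz; rewrite mulrA -expr2 hz; ring.
rewrite !expand.
set A0 := dot y (Q *m y); set al := dot (a k) (Q *m a k); set c := dot (a k) (Q *m y).
have -> : expR ((A0 + al + 2 * ((-1) ^+ e k * c)) / 2)
      + expR ((A0 + al + 2 * ((-1) ^+ (~~ e k) * c)) / 2)
    = expR ((A0 + al) / 2) * (expR c + expR (- c)).
  rewrite mulrDr -!expRD; case: (e k); rewrite ?expr0 ?expr1 /=; last first.
    by congr (expR _ + expR _); field.
  by rewrite addrC; congr (expR _ + expR _); field.
have h1 := dot_invmx_rank1 (a k) y w0 (coercive_shifted_gram k).
have h2 := dot_invmx_le (a k) w0 (coercive_shifted_gram k.+1).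
rewrite -shifted_gramS -/Q -/A0 -/c in h1; rewrite -/Q -/al in h2.
apply: (@le_trans _ _ (expR ((A0 + al) / 2) * (2 * expR (c ^+ 2 / 2)))).
  by rewrite ler_pM2l ?expR_gt0 // expR_cosh.
rewrite mulrCA ler_pM2l // -!expRD ler_expR; lra.
Qed.

Lemma sum_rademacher_potential k : (k <= N)%N ->
  \sum_e phi N e <= expR ((\sum_(i < N | (k <= i)%N) dot (a i) (a i)) / w / 2)
    * \sum_e phi k e.
Proof.
move=> kN; rewrite -(subKn kN); move: (leq_subr k N); set t := (N - k)%N; move: t.
elim => [|t IH] tN.
  rewrite subn0; set z := \sum_(i < N | _) _.
  have -> : z = 0 by rewrite /z big_pred0 // => i; rewrite leqNgt ltn_ord.
  by rewrite !mul0r expR0 mul1r.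
have [K [kE rtK]] : exists K : 'I_N, (N - t.+1)%N = K /\ (N - t)%N = K.+1.
  have k_lt : (N - t.+1 < N)%N by rewrite subnSK // leq_subr.
  by exists (Ordinal k_lt); rewrite /= subnSK.
apply: le_trans (IH (ltnW tN)) _; rewrite rtK kE.
rewrite (bigD1 (P := fun i : 'I_N => (K <= i)%N) K) //= addrC.
have -> : \sum_(i < N | (K <= i)%N && (i != K)) dot (a i) (a i)
    = \sum_(i < N | (K < i)%N) dot (a i) (a i).
  by apply: eq_bigl => i; rewrite ltn_neqAle andbC eq_sym -val_eqE.
rewrite !mulrDl expRD -[leRHS]mulrA ler_pM2l ?expR_gt0 //.
rewrite mulr_sumr; apply: (sum_flip_le (k := K)) => e.
exact: rademacher_potential_step.
Qed.

Lemma sum_expR_rademacher :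
  \sum_(e : {ffun 'I_N -> bool})
     expR (mu / 2 * dot (\sum_i (-1) ^+ e i *: a i) (\sum_i (-1) ^+ e i *: a i))
    <= (2 ^ N)%:R * expR (mu / 2 * (d%:R / (1 - mu))).
Proof.
case/andP: mu01 => m0 m1.
have BN : B N = (mu^-1)%:M.
  rewrite /B (eq_bigl predT) ?a1 => [|i]; last by rewrite ltn_ord.
  by rewrite -raddfD /= subrK.
have phiN e : phi N e =
    expR (mu / 2 * dot (\sum_i (-1) ^+ e i *: a i) (\sum_i (-1) ^+ e i *: a i)).
  have -> : \sum_i (-1) ^+ e i *: a i = partial_sum N e.
    by apply: eq_bigl => i; rewrite ltn_ord.
  rewrite /phi BN invmx_scalar invrK mul_scalar_mx dotZr; congr expR; ring.
rewrite -(eq_bigr _ (fun e _ => phiN e)).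
apply: le_trans (sum_rademacher_potential (leq0n N)) _.
have -> : \sum_e phi 0 e = (2 ^ N)%:R.
  rewrite (eq_bigr (fun=> 1)) => [|e _].
    by rewrite sumr_const card_ffun card_bool card_ord.
  by rewrite /phi /partial_sum big_pred0 // dot0l mul0r expR0.
have -> : \sum_(i < N | (0 <= i)%N) dot (a i) (a i) = d%:R.
  have := congr1 mxtrace a1; rewrite mxtrace_scalar => <-.
  rewrite raddf_sum; apply: eq_bigr => i _ /=.
  by rewrite -[a i *m _]mul1mx mxtrace_outer mul1mx.
rewrite mulrC ler_pM2l ?ltr0n ?expn_gt0 // ler_expR /w le_eqVlt; apply/orP; left.
apply/eqP; field; rewrite subr_eq0; lra.
Qed.

End Rademacher.

Lemma rademacher_tail (R : realType) (N d : nat) (a : 'I_N -> 'cV[R]_d) (t : R) :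
  \sum_i a i *m (a i)^T = 1%:M -> (0 < d)%N -> 0 < t ->
  #|[set e : {ffun 'I_N -> bool} |
     (Num.sqrt d%:R + Num.sqrt (2 * t)) ^+ 2
       < dot (\sum_i (-1) ^+ e i *: a i) (\sum_i (-1) ^+ e i *: a i)]|%:R
    <= (2 ^ N)%:R * expR (- t).
Proof.
move=> a1 d0 t0; set g := Num.sqrt d%:R; set u := Num.sqrt (2 * t).
have g0 : 0 < g by rewrite sqrtr_gt0 ltr0n.
have u0 : 0 < u by rewrite sqrtr_gt0; lra.
have gE : g ^+ 2 = d%:R by rewrite sqr_sqrtr.
have uE : u ^+ 2 = 2 * t by rewrite sqr_sqrtr //; lra.
have h0 : 0 < g + u by lra.
(* The optimal parameter: [1 - mu = g / (g + u)] is where the derivative of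
   [mu / 2 * (d / (1 - mu) - T)] vanishes, and the value there is [- u ^+ 2 / 2 = - t]. *)
pose mu := u / (g + u).
have mu01 : 0 < mu < 1.
  by rewrite divr_gt0 //= ltr_pdivrMr // mul1r; lra.
have H := sum_expR_rademacher a1 mu01.
set T := (g + u) ^+ 2.
have eT : mu / 2 * (d%:R / (1 - mu)) = mu / 2 * T - t.
  have -> : t = u ^+ 2 / 2 by rewrite uE; lra.
  by rewrite -gE /mu /T; field; rewrite addrK !gt_eqF.
rewrite eT in H.
rewrite -(ler_pM2l (expR_gt0 (mu / 2 * T))).
have -> : expR (mu / 2 * T) * ((2 ^ N)%:R * expR (- t))
    = (2 ^ N)%:R * expR (mu / 2 * T - t) by rewrite expRD; ring.
apply: le_trans H.
rewrite -sum1_card natr_sum mulr_sumr big_mkcond /=.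
apply: ler_sum => e _; rewrite inE; case: ifP => [he|_]; last exact: expR_ge0.
rewrite mulr1 ler_expR ler_pM2l ?ltW //.
by case/andP: mu01 => ? _; rewrite divr_gt0.
Qed.

(** * Sketched least squares *)

Section LinearAlgebra.
Variable R : realType.

Lemma norm2E n (v : 'cV[R]_n) : norm2 v = Num.sqrt (dot v v).
Proof. by congr Num.sqrt; apply: eq_bigr => i _; rewrite expr2. Qed.

Lemma norm2_ge0 n (v : 'cV[R]_n) : 0 <= norm2 v.
Proof. exact: sqrtr_ge0. Qed.

Lemma sqr_norm2 n (v : 'cV[R]_n) : norm2 v ^+ 2 = dot v v.
Proof. by rewrite norm2E sqr_sqrtr // dot_ge0. Qed.

Lemma norm2Z n c (v : 'cV[R]_n) : norm2 (c *: v) = `|c| * norm2 v.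
Proof.
by rewrite !norm2E dotZl dotZr mulrA -expr2 sqrtrM ?sqr_ge0 // sqrtr_sqr.
Qed.

Lemma norm2_le_sqr n k (u : 'cV[R]_n) (v : 'cV[R]_k) c : 0 <= c ->
  dot u u <= c * dot v v -> norm2 u <= Num.sqrt c * norm2 v.
Proof. by move=> c0 h; rewrite !norm2E -sqrtrM // ler_wsqrtr. Qed.

Lemma dot_mulmx_bound m n (M : 'M[R]_(m, n)) (x : 'cV[R]_n) :
  dot (M *m x) (M *m x) <= (\sum_i dot (row i M)^T (row i M)^T) * dot x x.
Proof.
rewrite mulr_suml; apply: ler_sum => i _.
have -> : (M *m x) i 0 = dot (row i M)^T x.
  by rewrite dotE trmxK -row_mul [RHS]mxE.
by rewrite -expr2 dot_CauchySchwarz.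
Qed.

Lemma norm2_le_specnorm m n (M : 'M[R]_(m, n)) (x : 'cV[R]_n) :
  norm2 x <= 1 -> norm2 (M *m x) <= specnorm M.
Proof.
move=> x1; apply: ub_le_sup; last by exists x.
(* The supremum is meaningful because the Frobenius norm bounds the set. *)
exists (Num.sqrt (\sum_i dot (row i M)^T (row i M)^T)) => _ [y /= y1 <-].
have F0 : 0 <= \sum_i dot (row i M)^T (row i M)^T.
  by apply: sumr_ge0 => i _; apply: dot_ge0.
apply: le_trans (norm2_le_sqr F0 (dot_mulmx_bound M y)) _.
by rewrite ler_piMr ?sqrtr_ge0.
Qed.

Lemma norm20 n : norm2 (0 : 'cV[R]_n) = 0.
Proof. by rewrite norm2E dot0r sqrtr0. Qed.

Lemma specnorm_ge0 m n (M : 'M[R]_(m, n)) : 0 <= specnorm M.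
Proof.
by have := @norm2_le_specnorm _ _ M 0; rewrite mulmx0 !norm20 ler01; apply.
Qed.

Lemma norm2_mulmx_le m n (M : 'M[R]_(m, n)) (x : 'cV[R]_n) :
  norm2 (M *m x) <= specnorm M * norm2 x.
Proof.
have [x0|x0] := eqVneq (norm2 x) 0.
  have /dot_eq0 -> : dot x x = 0 by rewrite -sqr_norm2 x0 expr0n.
  by rewrite mulmx0 !norm20 mulr0.
have xp : 0 < norm2 x by rewrite lt_neqAle eq_sym x0 norm2_ge0.
have xi : 0 <= (norm2 x)^-1 by rewrite invr_ge0 ltW.
rewrite -ler_pdivrMr // mulrC.
have -> : (norm2 x)^-1 * norm2 (M *m x) = norm2 (M *m ((norm2 x)^-1 *: x)).
  by rewrite -scalemxAr norm2Z ger0_norm.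
by apply: norm2_le_specnorm; rewrite norm2Z ger0_norm // mulVf.
Qed.

(** A column dependent on those already treated adds no basis vector, whence [d <= k]; this covers a
    [b] in the range of [A]. *)
Lemma gram_schmidt m k (F : 'M[R]_(m, k)) :
  exists d (W : 'M[R]_(m, d)) (T : 'M[R]_(d, k)),
    [/\ (d <= k)%N, W^T *m W = 1%:M & F = W *m T].
Proof.
elim: k F => [|k IH] F.
  exists 0%N, 0, 0; split => //; first by apply/matrixP => -[].
  by rewrite mul0mx; apply/matrixP => i [].
move: F; rewrite -[k.+1]add1n => F.
have [d [W [T [dk W1 FW]]]] := IH (rsubmx F).
pose f : 'cV[R]_m := lsubmx F.
have FE : F = row_mx f (W *m T) by rewrite -FW hsubmxK.
pose g := f - W *m (W^T *m f).
have Wg : W^T *m g = 0 by rewrite mulmxBr !mulmxA W1 mul1mx subrr.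
have fE : f = g + W *m (W^T *m f) by rewrite subrK.
have [g0|g0] := eqVneq (dot g g) 0.
  exists d, W, (row_mx (W^T *m f) T); split => //; first exact: leqW.
  by rewrite mul_mx_row FE {1}fE (dot_eq0 g0) add0r.
have gp : 0 < dot g g by rewrite lt_neqAle eq_sym g0 dot_ge0.
pose c := Num.sqrt (dot g g).
have c0 : c != 0 by rewrite gt_eqF // sqrtr_gt0.
pose h := c^-1 *: g.
have hh : h^T *m h = 1%:M.
  apply/matrixP => i j; rewrite !ord1 -dotE dotZl dotZr mxE eqxx /=.
  have -> : dot g g = c ^+ 2 by rewrite sqr_sqrtr // ltW.
  by field.
have Wh : W^T *m h = 0 by rewrite -scalemxAr Wg scaler0.
have hW : h^T *m W = 0 by rewrite -[W]trmxK -trmx_mul Wh trmx0.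
exists (1 + d)%N, (row_mx h W), (block_mx c%:M 0 (W^T *m f) T).
split; first by rewrite !add1n ltnS.
  by rewrite tr_row_mx mul_col_row hh hW Wh W1 -scalar_mx_block.
rewrite mul_row_block mulmx0 add0r FE {1}fE mul_mx_scalar scalerA mulfV //.
by rewrite scale1r.
Qed.

Lemma dot_orthonormal m d (W : 'M[R]_(m, d)) (x y : 'cV[R]_d) :
  W^T *m W = 1%:M -> dot (W *m x) (W *m y) = dot x y.
Proof. by move=> W1; rewrite dot_mulmx_tr mulmxA W1 mul1mx. Qed.

Lemma dot_sub_orth m (x y : 'cV[R]_m) : dot x y = 0 ->
  dot (x - y) (x - y) = dot x x + dot y y.
Proof. by move=> h; rewrite !(dotBl, dotBr) (dotC y x) h; ring. Qed.

Lemma normal_equations m n (F : 'M[R]_(m, n)) (c : 'cV[R]_m) :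
  F^T *m (c - F *m (pseudoinverse F *m c)) = 0.
Proof.
have [p1 p2 p3 p4] := pseudoinverseP F.
rewrite mulmxBr !mulmxA -[F^T *m F *m _]mulmxA -p3 -trmx_mul p1.
exact: subrr.
Qed.

Lemma pseudoinverse_mulmx m n (F : 'M[R]_(m, n)) : \rank F = n ->
  pseudoinverse F *m F = 1%:M.
Proof.
move=> /gram_unit uF; have [p1 _ _ _] := pseudoinverseP F.
apply: (can_inj (mulKmx uF)).
by rewrite mulmx1 -!mulmxA [F *m _]mulmxA p1.
Qed.

(** Polarisation with [x + y] and [x - y]; the parallelogram law adds up the two errors. *)
Lemma near_isometry_dot d (eta : R) (S : 'M[R]_d) (x y : 'cV[R]_d) : S^T = S ->
  near_isometry eta S ->
  dot x (S *m y) - dot x y <= eta / 2 * (dot x x + dot y y).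
Proof.
move=> symS h.
have := h (x + y); have := h (x - y).
rewrite !ler_norml => /andP[h1 _] /andP[_ h2].
have yx : dot y (S *m x) = dot x (S *m y) by rewrite dot_mulmx_tr symS dotC.
rewrite !mulmxBr !mulmxDr !(dotBl, dotBr, dotDl, dotDr) !(dotC y x) yx in h1 h2.
lra.
Qed.

(** * Deterministic error bounds under a near-isometry *)

Section Sketch.
Variables (m n r d : nat) (A : 'M[R]_(m, n)) (b : 'cV[R]_m) (Th : 'M[R]_(r, m)).
Variables (W : 'M[R]_(m, d)) (TA : 'M[R]_(d, n)) (tb : 'cV[R]_d) (eta : R).
Hypotheses (W1 : W^T *m W = 1%:M) (AE : A = W *m TA) (bE : b = W *m tb).
Hypotheses (eta01 : 0 < eta < 1).
Hypothesis isoTh : near_isometry eta ((Th *m W)^T *m (Th *m W)).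

Let x_opt := pseudoinverse A *m b.
Let x_sk := pseudoinverse (Th *m A) *m (Th *m b).
Let rho := b - A *m x_opt.
Let u := A *m (x_sk - x_opt).

Lemma residual_orth (z : 'cV[R]_n) : dot (A *m z) rho = 0.
Proof. by rewrite dotC dot_mulmx_tr normal_equations dot0l. Qed.

(** In the coordinates of [W], the sketched normal equations make [u'] orthogonal to [rho' - u'] for
    the form [S], whereas the true inner product is [- dot u' u']. The squared error is thus pure
    distortion. *)
Lemma sketch_error_le : dot u u <= eta ^+ 2 / (1 - eta ^+ 2) * dot rho rho.
Proof.
have [eta0 eta1] := andP eta01.
have [u' uE] : exists u', u = W *m u'.
  by exists (TA *m (x_sk - x_opt)); rewrite /u AE mulmxA.
have [rho' rE] : exists rho', rho = W *m rho'.
  by exists (tb - TA *m x_opt); rewrite /rho mulmxBr -bE [W *m (TA *m _)]mulmxA -AE.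
have iso := isoTh; set S := _^T *m _ in iso.
have symS : S^T = S by rewrite trmx_mul trmxK.
have ne : dot u' (S *m (rho' - u')) = 0.
  have -> : S *m (rho' - u') = (Th *m W)^T *m (Th *m b - Th *m A *m x_sk).
    rewrite /S -[LHS]mulmxA -[Th *m W *m _]mulmxA mulmxBr -uE -rE.
    rewrite -[Th *m A *m _]mulmxA -mulmxBr; congr (_ *m (_ *m _)).
    by rewrite /rho /u mulmxBr opprB addrA subrK.
  rewrite dot_mulmx_tr trmxK -[Th *m W *m u']mulmxA -uE /u mulmxA dotC dot_mulmx_tr.
  by rewrite normal_equations dot0l.
have ur : dot u' rho' = 0 by rewrite -(dot_orthonormal _ _ W1) -uE -rE residual_orth.
rewrite uE rE !(dot_orthonormal _ _ W1).
(* The factor [eta] gives both arguments the same norm in the extremal case, where the polarised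
   bound loses nothing. *)
have := near_isometry_dot u' (eta *: (rho' - u')) symS iso.
rewrite -scalemxAr !(dotZl, dotZr) ne !(dotBl, dotBr) (dotC rho' u') ur.
set X := dot u' u'; set Y := dot rho' rho' => h.
have e2 : 0 < 1 - eta ^+ 2 by nra.
rewrite mulrAC ler_pdivlMr //.
suff : eta * (X * (1 - eta ^+ 2)) <= eta * (eta ^+ 2 * Y) by rewrite ler_pM2l.
by lra.
Qed.

(** Pythagoras adds [1] to the factor of [sketch_error_le], which gives [(1 - eta ^+ 2)^-1]. *)
Lemma sketch_residual_le c : 0 <= c -> (1 - eta ^+ 2)^-1 <= c ^+ 2 ->
  norm2 (A *m x_sk - b) <= c * norm2 (A *m x_opt - b).
Proof.
move=> c0 hc; have [eta0 eta1] := andP eta01.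
have -> : A *m x_sk - b = u - rho by rewrite /u /rho mulmxBr opprB addrA subrK.
have -> : A *m x_opt - b = - rho by rewrite opprB.
rewrite -(ger0_norm c0) -sqrtr_sqr; apply: norm2_le_sqr; first exact: sqr_ge0.
rewrite (dot_sub_orth (residual_orth _)) dotNl dotNr opprK.
have h := sketch_error_le; have r0 := dot_ge0 rho.
have e2 : 0 < 1 - eta ^+ 2 by nra.
have := ler_wpM2r r0 hc.
have eE : eta ^+ 2 / (1 - eta ^+ 2) = (1 - eta ^+ 2)^-1 - 1.
  by field; rewrite gt_eqF.
rewrite eE in h.
lra.
Qed.

Hypothesis rA : \rank A = n.

(** Full rank makes [N] invertible, so [U] and [A] have the same range and [U *m U^T] and
    [A *m pseudoinverse A] are the same orthogonal projection. *)
Lemma left_singular_proj U : left_singular_vectors A U ->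
  U *m U^T *m b = A *m x_opt.
Proof.
move=> [s [V [U1 V1 _ AU]]]; have [p1 _ p3 _] := pseudoinverseP A.
set N := diag_mx s *m V^T; have AN : A = U *m N by rewrite AU -mulmxA.
have uN : N \in unitmx.
  rewrite -row_full_unit /row_full eqn_leq rank_leq_col /= -[X in (X <= _)%N]rA.
  by rewrite [in X in (X <= _)%N]AN mxrankM_maxr.
set P := A *m pseudoinverse A in p1 p3.
have PU : P *m U = U.
  apply: (can_inj (mulmxK uN)); by rewrite -mulmxA -AN.
have UP : U^T *m P = U^T by rewrite -p3 -trmx_mul PU.
rewrite /x_opt mulmxA -/P; congr (_ *m _).
have PE : P = U *m (N *m pseudoinverse A) by rewrite mulmxA -AN.
by rewrite -UP PE [U^T *m _]mulmxA U1 mul1mx.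
Qed.

(** [gamma] is the cosine of the angle between [b] and the range of [A], so [gamma ^- 2 - 1] is its
    squared tangent and converts [rho] into [A *m x_opt]. The factors of [cond2 A] come from
    [x_opt - x_sk = - (pseudoinverse A *m u)] and from bounding [A *m x_opt] by [x_opt]. *)
Lemma sketch_solution_le U gamma c : left_singular_vectors A U ->
  0 < gamma <= 1 -> norm2 (U *m U^T *m b) = gamma * norm2 b ->
  eta ^+ 2 / (1 - eta ^+ 2) <= c ->
  norm2 (x_opt - x_sk)
    <= Num.sqrt c * cond2 A * Num.sqrt (gamma ^- 2 - 1) * norm2 x_opt.
Proof.
move=> hU /andP[g0 g1] hg hc; have [eta0 eta1] := andP eta01.
rewrite (left_singular_proj hU) in hg.
have e2 : 0 < 1 - eta ^+ 2 by nra.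
have K0 : 0 <= eta ^+ 2 / (1 - eta ^+ 2) by rewrite divr_ge0 ?sqr_ge0 // ltW.
have c0 : 0 <= c by apply: le_trans hc.
have zE : x_opt - x_sk = - (pseudoinverse A *m u).
  by rewrite /u mulmxA pseudoinverse_mulmx // mul1mx opprB.
have gi : 1 <= gamma ^- 2 by rewrite -exprVn exprn_ege1 // invf_ge1.
have rhoE : dot rho rho = (gamma ^- 2 - 1) * dot (A *m x_opt) (A *m x_opt).
  have bb : dot b b = dot (A *m x_opt) (A *m x_opt) + dot rho rho.
    have {1 2}-> : b = A *m x_opt - (- rho) by rewrite opprK addrC subrK.
    by rewrite dot_sub_orth ?dotNr ?dotNl ?opprK // residual_orth oppr0.
  have gg : dot (A *m x_opt) (A *m x_opt) = gamma ^+ 2 * dot b b.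
    by rewrite -!sqr_norm2 hg exprMn.
  have -> : dot rho rho = dot b b - dot (A *m x_opt) (A *m x_opt).
    by rewrite bb addrAC subrr add0r.
  by rewrite gg; field; rewrite gt_eqF.
have h1 : norm2 u <= Num.sqrt c * norm2 rho.
  apply: norm2_le_sqr => //; apply: le_trans sketch_error_le _.
  by rewrite ler_wpM2r // dot_ge0.
have h2 : norm2 rho <= Num.sqrt (gamma ^- 2 - 1) * norm2 (A *m x_opt).
  by apply: norm2_le_sqr; rewrite ?subr_ge0 // rhoE.
have h3 := norm2_mulmx_le A x_opt.
have h4 := norm2_mulmx_le (pseudoinverse A) u.
rewrite zE -scaleN1r norm2Z normrN normr1 mul1r.
apply: le_trans h4 _.
apply: (@le_trans _ _ (specnorm (pseudoinverse A) *
   (Num.sqrt c * (Num.sqrt (gamma ^- 2 - 1) * (specnorm A * norm2 x_opt))))).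
  rewrite ler_wpM2l ?specnorm_ge0 //; apply: le_trans h1 _; rewrite ler_wpM2l ?sqrtr_ge0 //.
  by apply: le_trans h2 _; rewrite ler_wpM2l ?sqrtr_ge0.
rewrite /cond2 le_eqVlt; apply/orP; left; apply/eqP; ring.
Qed.

End Sketch.

End LinearAlgebra.

(** * The subsampled randomized Hadamard transform *)

Section Hadamard.
Variable R : realType.

Lemma hadamard_sqr p i j : hadamard R p i j ^+ 2 = 1.
Proof.
elim: p i j => [|p IH] i j.
  by rewrite /= mxE (ord1 (i : 'I_1)) (ord1 (j : 'I_1)) eqxx expr1n.
rewrite /= castmxE /block_mx mxE; case: splitP => i' _; rewrite mxE;
  by case: splitP => j' _; rewrite ?mxE ?sqrrN IH.
Qed.

Lemma gramZ m n (c : R) (A : 'M[R]_(m, n)) :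
  (c *: A)^T *m (c *: A) = c ^+ 2 *: (A^T *m A).
Proof.
have -> : (c *: A)^T = c *: A^T by exact: linearZ.
by rewrite -scalemxAl -scalemxAr scalerA expr2.
Qed.

Lemma castmx_gram m n (e : m = n) (A : 'M[R]_m) :
  (castmx (e, e) A)^T *m castmx (e, e) A = castmx (e, e) (A^T *m A).
Proof. by case: n / e; rewrite !castmx_id. Qed.

Lemma castmx_scalar m n (e : m = n) (c : R) : castmx (e, e) c%:M = c%:M.
Proof. by case: n / e; rewrite castmx_id. Qed.

Lemma hadamard_gram p : (hadamard R p)^T *m hadamard R p = (2 ^ p)%:R%:M.
Proof.
elim: p => [|p IH]; first by rewrite /= trmx1 mulmx1 expn0.
have trN : (- hadamard R p)^T = - (hadamard R p)^T by exact: linearN.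
rewrite /= castmx_gram tr_block_mx mulmx_block trN !(mulNmx, mulmxN) opprK IH subrr.
have -> : (2 ^ p)%:R%:M + (2 ^ p)%:R%:M = (2 ^ p.+1)%:R%:M :> 'M[R]_(2 ^ p).
  by rewrite -raddfD -natrD addnn -mul2n -expnS.
by rewrite -scalar_mx_block castmx_scalar.
Qed.

Lemma normalized_hadamard_gram p :
  (normalized_hadamard R p)^T *m normalized_hadamard R p = 1%:M.
Proof.
have p0 : 0 < (2 ^ p)%:R :> R by rewrite ltr0n expn_gt0.
rewrite gramZ hadamard_gram scale_scalar_mx exprVn sqr_sqrtr ?ltW //.
by rewrite mulVf // gt_eqF.
Qed.

Lemma sign_mx_gram N (e : {ffun 'I_N -> bool}) : (sign_mx R e)^T *m sign_mx R e = 1%:M.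
Proof.
rewrite tr_diag_mx mulmx_diag -diag_const_mx; congr diag_mx.
by apply/rowP => j; rewrite !mxE -expr2 sqrr_sign.
Qed.

End Hadamard.

(** * Failure probability of the embedding *)

Section Embedding.
Variables (R : realType) (p d r : nat) (W : 'M[R]_(2 ^ p, d)).
Local Notation m := (2 ^ p)%N.
Hypotheses (W1 : W^T *m W = 1%:M) (d0 : (0 < d)%N) (r0 : (0 < r)%N) (rm : (r <= m)%N).

Let m0 : (0 < m)%N. Proof. by rewrite expn_gt0. Qed.
Let mR : 0 < m%:R :> R. Proof. by rewrite ltr0n. Qed.
Let rR : 0 < r%:R :> R. Proof. by rewrite ltr0n. Qed.

Definition sketch_rows (e : {ffun 'I_m -> bool}) : 'M[R]_(m, d) :=
  Num.sqrt (m%:R / r%:R) *: (normalized_hadamard R p *m sign_mx R e *m W).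

Definition sketch_vec e (j : 'I_m) : 'cV[R]_d := (row j (sketch_rows e))^T.

Lemma srht_mul (w : srht_outcome r m) : srht R w *m W = rowsub w.2 (sketch_rows w.1).
Proof.
rewrite /srht /sampling_mx /sketch_rows -scalemxAl !mul_rowsub_mx mul1mx.
by apply/matrixP => i j; rewrite [LHS]mxE [X in _ * X]mxE [RHS]mxE [RHS]mxE.
Qed.

Lemma sum_outer_row k (M : 'M[R]_(m, d)) (s : 'I_k -> 'I_m) :
  \sum_i (row (s i) M)^T *m ((row (s i) M)^T)^T = (rowsub s M)^T *m rowsub s M.
Proof.
apply/matrixP => i j; rewrite summxE !mxE; apply: eq_bigr => k' _.
by rewrite !mxE big_ord1 !mxE.
Qed.

Lemma gram_srht (w : srht_outcome r m) :
  (srht R w *m W)^T *m (srht R w *m W) = gram (sketch_vec w.1) w.2.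
Proof. by rewrite srht_mul /gram sum_outer_row. Qed.

Lemma sum_sketch_vec e : \sum_j sketch_vec e j *m (sketch_vec e j)^T = (m%:R / r%:R)%:M.
Proof.
rewrite (sum_outer_row (sketch_rows e) id).
have -> : rowsub id (sketch_rows e) = sketch_rows e by apply/matrixP => i j; rewrite mxE.
rewrite gramZ sqr_sqrtr ?divr_ge0 ?ltW //.
set D := sign_mx R e; set H := normalized_hadamard R p.
have -> : (H *m D *m W)^T *m (H *m D *m W) = 1%:M.
  rewrite !trmx_mul !mulmxA -[_ *m H^T *m H]mulmxA normalized_hadamard_gram mulmx1.
  by rewrite -[_ *m D^T *m D]mulmxA sign_mx_gram mulmx1.
by rewrite scale_scalar_mx mulr1.
Qed.

Definition hadamard_atom (j k : 'I_m) : 'cV[R]_d := hadamard R p j k *: (row k W)^T.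

(** Hadamard entries square to one, so for every [j] the outer products are those of the rows of
    [W]. *)
Lemma sum_hadamard_atom j : \sum_k hadamard_atom j k *m (hadamard_atom j k)^T = 1%:M.
Proof.
rewrite -W1; have -> : W^T *m W = \sum_k (row k W)^T *m ((row k W)^T)^T.
  rewrite (sum_outer_row W id); have -> : rowsub id W = W by apply/matrixP => i k; rewrite mxE.
  by [].
apply: eq_bigr => k _.
have -> : (hadamard_atom j k)^T = hadamard R p j k *: ((row k W)^T)^T by exact: linearZ.
by rewrite -scalemxAl -scalemxAr scalerA -expr2 hadamard_sqr scale1r.
Qed.

Lemma sketch_vecE e j :
  sketch_vec e j = (Num.sqrt r%:R)^-1 *: \sum_k (-1) ^+ e k *: hadamard_atom j k.
Proof.
apply/matrixP => i z; rewrite ord1 !mxE summxE {z}.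
have -> : Num.sqrt (m%:R / r%:R) = Num.sqrt m%:R * (Num.sqrt r%:R)^-1 :> R.
  by rewrite sqrtrM ?ltW // sqrtrV ?ltW.
rewrite mulrAC [RHS]mulrC; congr (_ * _); rewrite mulr_sumr.
apply: eq_bigr => k _; rewrite /sign_mx mul_mx_diag !mxE.
have sm : Num.sqrt m%:R != 0 :> R by rewrite gt_eqF // sqrtr_gt0.
by field.
Qed.

Definition flat_signs (T : R) (e : {ffun 'I_m -> bool}) : bool :=
  [forall j, dot (\sum_k (-1) ^+ e k *: hadamard_atom j k)
                 (\sum_k (-1) ^+ e k *: hadamard_atom j k) <= T].

Lemma card_not_flat (t : R) : 0 < t ->
  #|[set e | ~~ flat_signs ((Num.sqrt d%:R + Num.sqrt (2 * t)) ^+ 2) e]|%:R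
    <= (2 ^ m)%:R * (m%:R * expR (- t)) :> R.
Proof.
move=> t0; set T := _ ^+ 2.
pose bad j := [set e : {ffun 'I_m -> bool} | T <
  dot (\sum_k (-1) ^+ e k *: hadamard_atom j k) (\sum_k (-1) ^+ e k *: hadamard_atom j k)].
have sub : [set e | ~~ flat_signs T e] \subset \bigcup_j bad j.
  apply/fintype.subsetP => e; rewrite inE negb_forall => /existsP[j].
  by rewrite -ltNge => h; apply/bigcupP; exists j; rewrite ?inE.
apply: (@le_trans _ _ (\sum_j #|bad j|%:R)).
  rewrite -natr_sum ler_nat; apply: leq_trans (subset_leq_card sub) _.
  apply: (big_ind2 (fun (S : {set {ffun 'I_m -> bool}}) k => (#|S| <= k)%N)) => //.
    by rewrite cards0.
  move=> S k S' k' hS hS'; apply: leq_trans (leq_add hS hS').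
  by rewrite cardsU leq_subr.
apply: (@le_trans _ _ (\sum_(j < m) (2 ^ m)%:R * expR (- t))).
  by apply: ler_sum => j _; apply: rademacher_tail => //; exact: sum_hadamard_atom.
rewrite sumr_const card_ord -mulr_natl le_eqVlt; apply/orP; left; apply/eqP; ring.
Qed.

Lemma card_not_embedding (t eta : R) : 0 < t -> 0 < eta <= 1 / 2 ->
  #|[set w in srht_space r m |
      ~~ `[< near_isometry eta ((srht R w *m W)^T *m (srht R w *m W)) >]]|%:R
    <= #|srht_space r m|%:R * (m%:R * expR (- t) + 2 * d%:R
       * expR (- (eta ^+ 2 * r%:R / (4 * (Num.sqrt d%:R + Num.sqrt (2 * t)) ^+ 2)))).
Proof.
move=> t0 heta; set T := (_ + _) ^+ 2; set X := 2 * _ * _.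
have T0 : 0 < T.
  by rewrite exprn_gt0 // ltr_wpDr ?sqrtr_ge0 // sqrtr_gt0 ltr0n.
pose inj : {set {ffun 'I_r -> 'I_m}} := [set s : {ffun 'I_r -> 'I_m} | injectiveb s].
have spaceE : #|srht_space r m| = (2 ^ m * #|inj|)%N.
  have -> : srht_space r m = finset.setX [set: {ffun 'I_m -> bool}] inj.
    by apply/setP => -[e s]; rewrite !inE.
  by rewrite cardsX cardsT card_ffun card_bool card_ord.
have X0 : 0 <= X by rewrite /X !mulr_ge0 ?expR_ge0.
pose badp (w : srht_outcome r m) :=
  injectiveb w.2 && ~~ `[< near_isometry eta (gram (sketch_vec w.1) w.2) >].
(* Conditioning on the signs: if they are not flat, every sample counts as a failure; if they are,
   the Chernoff bound applies with [beta = T / r] and [tau = m / r]. *)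
have step e : \sum_(s | badp (e, s)) 1 <= #|inj|%:R * (X + (~~ flat_signs T e)%:R).
  have [flat|nflat] := boolP (flat_signs T e); last first.
    rewrite mulrDr mulr1; apply: (@le_trans _ _ #|inj|%:R); last first.
      by rewrite lerDr mulr_ge0.
    rewrite -sum1_card natr_sum big_mkcond [leRHS]big_mkcond; apply: ler_sum => s _.
    by rewrite /badp inE /=; case: (injectiveb s) => //=; case: ifP.
  rewrite addr0; pose beta := T / r%:R.
  have beta0 : 0 < beta by rewrite divr_gt0.
  have vb j : dot (sketch_vec e j) (sketch_vec e j) <= beta.
    rewrite sketch_vecE dotZl dotZr mulrA -invfM -expr2 sqr_sqrtr ?ler0n //.
    rewrite [leLHS]mulrC /beta ler_pM2r ?invr_gt0 //.
    by move/forallP: flat; apply.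
  have tau0 : 0 <= m%:R / r%:R :> R by rewrite divr_ge0 ?ltW.
  have mean1 : m%:R / r%:R * (r%:R / m%:R) = 1 :> R.
    by field; rewrite !gt_eqF.
  have := card_not_near_isometry beta0 vb tau0 (sum_sketch_vec e) rm m0 mean1 heta.
  rewrite -/inj -sum1_card natr_sum.
  have -> : eta ^+ 2 / (4 * beta) = eta ^+ 2 * r%:R / (4 * T).
    by rewrite /beta; field; rewrite !gt_eqF.
  rewrite -/X => h; apply: le_trans h; rewrite le_eqVlt; apply/orP; left; apply/eqP.
  by apply: eq_bigl => s; rewrite /badp inE.
have -> : #|[set w in srht_space r m |
      ~~ `[< near_isometry eta ((srht R w *m W)^T *m (srht R w *m W)) >]]|%:R
    = \sum_e \sum_(s | badp (e, s)) 1 :> R.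
  rewrite -sum1_card natr_sum pair_big_dep /=; apply: eq_bigl => -[e s].
  by rewrite inE gram_srht /badp inE.
apply: (@le_trans _ _ (\sum_e #|inj|%:R * (X + (~~ flat_signs T e)%:R))).
  exact: ler_sum.
rewrite -mulr_sumr big_split /= sumr_const card_ffun card_bool card_ord.
have -> : \sum_e (~~ flat_signs T e)%:R = #|[set e | ~~ flat_signs T e]|%:R :> R.
  rewrite -sum1_card natr_sum [RHS]big_mkcond; apply: eq_bigr => e _.
  by rewrite inE; case: (flat_signs T e).
have h := card_not_flat t0; rewrite -/T in h.
have {}h := ler_wpM2l (ler0n R #|inj|) h.
rewrite spaceE natrM -[X *+ _]mulr_natl mulrDr.
apply: le_trans (_ : #|inj|%:R * ((2 ^ m)%:R * X)
  + #|inj|%:R * ((2 ^ m)%:R * (m%:R * expR (- t))) <= _).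
  by rewrite lerD2l.
by rewrite le_eqVlt; apply/orP; left; apply/eqP; ring.
Qed.

End Embedding.

(** * Choice of the parameters *)

Section SrhtProb.
Variables (R : realType) (r N : nat).

Lemma srht_prob_ge0 (E : pred (srht_outcome r N)) : 0 <= srht_prob R E.
Proof. by rewrite divr_ge0. Qed.

Lemma card_srht_space_gt0 : (r <= N)%N -> (0 < #|srht_space r N|)%N.
Proof.
move=> rN; apply/card_gt0P; exists ([ffun=> false], [ffun i => widen_ord rN i]).
rewrite inE; apply/injectiveP => i j /=; rewrite !ffunE => /(congr1 val) /= h.
exact: val_inj.
Qed.

Lemma srht_prob_ge (E F : pred (srht_outcome r N)) (c : R) : (r <= N)%N ->
  (forall w, F w -> E w) ->
  #|[set w in srht_space r N | ~~ F w]|%:R <= #|srht_space r N|%:R * c ->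
  1 - c <= srht_prob R E.
Proof.
move=> rN FE hF; have s0 : 0 < #|srht_space r N|%:R :> R.
  by rewrite ltr0n card_srht_space_gt0.
rewrite ler_pdivlMr // mulrBl mul1r lerBlDr.
apply: le_trans (_ : #|[set w in srht_space r N | E w]|%:R
    + #|[set w in srht_space r N | ~~ F w]|%:R <= _); last first.
  by rewrite lerD2l mulrC.
rewrite -natrD ler_nat; apply: leq_trans (leq_card_setU _ _).
apply: subset_leq_card; apply/fintype.subsetP => w ws; rewrite !inE.
move: ws; rewrite inE => ->; case Fw : (F w) => //=; first by rewrite FE.
by rewrite orbT.
Qed.

End SrhtProb.

Section SampleSize.
Variables (R : realType) (m n r d : nat) (eps delta C : R).
Hypotheses (hn : (0 < n)%N) (hm : (0 < m)%N) (dn : (d <= n.+1)%N) (d0 : (0 < d)%N).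
Hypotheses (heps : 0 < eps < 1 / 3) (hdelta : 0 < delta < 1 / 7) (hC : 1 <= C).
Local Notation L := (ln (m%:R / delta)).
Local Notation l := (ln (n%:R / delta)).
Hypothesis hr : 6 * C ^+ 2 * eps^-1 * (Num.sqrt n%:R + Num.sqrt (8 * L)) ^+ 2 * l <= r%:R.

Let delta0 : 0 < delta. Proof. by case/andP: hdelta. Qed.

Lemma expR_ln_div k : (0 < k)%N -> expR (ln (k%:R / delta)) = k%:R / delta.
Proof. by move=> k0; rewrite lnK // posrE divr_gt0 // ltr0n. Qed.

Lemma ln_div_ge k : (0 < k)%N -> 1 / 2 <= ln (k%:R / delta).
Proof.
move=> k0; rewrite -ler_expR expR_ln_div //.
have h : 1 / 2 <= expR (- (1 / 2)) :> R.
  by apply: le_trans (expR_ge1Dx _); lra.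
have e : expR (1 / 2) * expR (- (1 / 2)) = 1 :> R by rewrite expRxMexpNx_1.
have k1 : 1 <= k%:R :> R by rewrite ler1n.
have ep := expR_gt0 (1 / 2 : R).
apply: (@le_trans _ _ 2); first by nra.
by case/andP: hdelta => _ h7; rewrite ler_pdivlMr //; lra.
Qed.

(** The [8] in place of [2] doubles the second root, and the surplus [Num.sqrt (2 * L) >= 1] absorbs
    the passage from [n] to the dimension [n + 1] caused by [b]. *)
Lemma sqrt_dim_le :
  (Num.sqrt d%:R + Num.sqrt (2 * L)) ^+ 2 <= (Num.sqrt n%:R + Num.sqrt (8 * L)) ^+ 2.
Proof.
have L1 := ln_div_ge hm.
have -> : 8 * L = 2 ^+ 2 * (2 * L) by ring.
rewrite [Num.sqrt (2 ^+ 2 * _)]sqrtrM ?sqr_ge0 // sqrtr_sqr ger0_norm //.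
have h1 : 1 <= Num.sqrt (2 * L).
  by rewrite -{1}sqrtr1 ler_wsqrtr //; lra.
have h2 : Num.sqrt d%:R <= Num.sqrt n%:R + 1 :> R.
  have s0 := sqrtr_ge0 (n%:R : R).
  rewrite -[leRHS]ger0_norm; last by lra.
  rewrite -sqrtr_sqr ler_wsqrtr // sqrrD1 sqr_sqrtr ?ler0n //.
  apply: le_trans (_ : n.+1%:R <= _); first by rewrite ler_nat.
  by rewrite -natr1; lra.
have h3 := sqrtr_ge0 (d%:R : R); have h4 := sqrtr_ge0 (n%:R : R).
by rewrite ler_sqr ?nnegrE; lra.
Qed.

Let B := (Num.sqrt n%:R + Num.sqrt (8 * L)) ^+ 2.

Let B0 : 0 < B.
Proof.
by rewrite exprn_gt0 // ltr_wpDr ?sqrtr_ge0 // sqrtr_gt0 ltr0n.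
Qed.

Lemma samples_ge : 6 * eps^-1 * B * l <= r%:R.
Proof.
apply: le_trans hr; case/andP: heps => e0 _.
have l0 := ln_div_ge hn.
have p : 0 <= eps^-1 * B * l.
  apply: mulr_ge0; last by lra.
  by apply: mulr_ge0; [rewrite invr_ge0 ltW | exact: ltW].
have c2 : 1 <= C ^+ 2 by rewrite exprn_ege1.
have := ler_wpM2r p c2; rewrite mul1r -/B => h.
have -> : 6 * eps^-1 * B * l = 6 * (eps^-1 * B * l) by ring.
have -> : 6 * C ^+ 2 * eps^-1 * B * l = 6 * (C ^+ 2 * (eps^-1 * B * l)) by ring.
by rewrite ler_pM2l.
Qed.

Lemma samples_gt0 : (0 < r)%N.
Proof.
rewrite -(ltr0n R); apply: lt_le_trans samples_ge; case/andP: heps => e0 _.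
have l0 := ln_div_ge hn.
apply: mulr_gt0; last by lra.
apply: mulr_gt0; last exact: B0.
by apply: mulr_gt0 => //; rewrite invr_gt0.
Qed.

(** The signs cost [delta]. The sample size brings each trace tail down to [delta / n] per
    dimension, and two tails in dimension [d <= n + 1 <= 2 * n] cost [4 * delta]. *)
Lemma failure_le :
  m%:R * expR (- L) + 2 * d%:R
    * expR (- (2 / 3 * eps * r%:R / (4 * (Num.sqrt d%:R + Num.sqrt (2 * L)) ^+ 2)))
  <= 5 * delta.
Proof.
case/andP: heps => e0 _; have l0 := ln_div_ge hn.
have mR : 0 < m%:R :> R by rewrite ltr0n.
have nR : 0 < n%:R :> R by rewrite ltr0n.
have dR : 0 < d%:R :> R by rewrite ltr0n.
have -> : m%:R * expR (- L) = delta.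
  by rewrite expRN expR_ln_div //; field; rewrite !gt_eqF.
set T := _ ^+ 2.
have T0 : 0 < T.
  by rewrite exprn_gt0 // ltr_wpDr ?sqrtr_ge0 // sqrtr_gt0.
have TB : T <= B := sqrt_dim_le.
have el : expR (- l) = delta / n%:R.
  by rewrite expRN expR_ln_div // invf_div.
have hx : expR (- (2 / 3 * eps * r%:R / (4 * T))) <= delta / n%:R.
  rewrite -el ler_expR lerN2 ler_pdivlMr; last by lra.
  have := ler_wpM2l (ltW e0) samples_ge.
  have -> : eps * (6 * eps^-1 * B * l) = 6 * (B * l) by field; rewrite gt_eqF.
  have l00 : 0 <= l by lra.
  have := ler_wpM2r l00 TB; lra.
have h2 : 2 * d%:R * expR (- (2 / 3 * eps * r%:R / (4 * T)))
    <= 2 * d%:R * (delta / n%:R).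
  by rewrite ler_pM2l // mulr_gt0.
have d2 : d%:R <= 2 * n%:R :> R.
  rewrite -natrM ler_nat; apply: leq_trans dn _.
  by rewrite mul2n -addnn -add1n leq_add2r.
have h3 : 2 * d%:R * (delta / n%:R) <= 4 * delta.
  rewrite mulrA ler_pdivrMr //.
  have := ler_wpM2r (ltW delta0) d2; lra.
lra.
Qed.

End SampleSize.

Lemma exists_srht_embedding (R : realType) (p n r : nat)
    (A : 'M[R]_(2 ^ p, n)) (b : 'cV[R]_(2 ^ p)) (eps delta C : R) :
  (0 < n)%N -> \rank A = n -> 0 < eps < 1 / 3 -> 0 < delta < 1 / 7 -> 1 <= C ->
  6 * C ^+ 2 * eps^-1
    * (Num.sqrt n%:R + Num.sqrt (8 * ln ((2 ^ p)%:R / delta))) ^+ 2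
    * ln (n%:R / delta) <= r%:R ->
  (r <= 2 ^ p)%N ->
  exists d (W : 'M[R]_(2 ^ p, d)) TA tb,
    [/\ W^T *m W = 1%:M, A = W *m TA, b = W *m tb &
     #|[set w in srht_space r (2 ^ p) |
        ~~ `[< near_isometry (Num.sqrt (2 / 3 * eps))
                ((srht R w *m W)^T *m (srht R w *m W)) >]]|%:R
     <= #|srht_space r (2 ^ p)|%:R * (5 * delta) :> R].
Proof.
move=> hn rA heps hdelta hC hr rm.
have [d [W [T [dn W1 E]]]] := gram_schmidt (row_mx A b).
have AE : A = W *m lsubmx T.
  by rewrite -(row_mxKl A b) E -[T in LHS]hsubmxK mul_mx_row row_mxKl.
have bE : b = W *m rsubmx T.
  by rewrite -(row_mxKr A b) E -[T in LHS]hsubmxK mul_mx_row row_mxKr.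
have d0 : (0 < d)%N.
  apply: leq_trans hn _; rewrite -rA AE.
  by apply: leq_trans (mxrankM_maxl _ _) _; exact: rank_leq_col.
rewrite addn1 in dn.
have m0 : (0 < 2 ^ p)%N by rewrite expn_gt0.
have r0 := samples_gt0 hn heps hdelta hC hr.
exists d, W, (lsubmx T), (rsubmx T); split => //.
case/andP: (heps) => e0 e1.
have L0 : 0 < ln ((2 ^ p)%:R / delta).
  by have := ln_div_ge hdelta m0; lra.
have eE : Num.sqrt (2 / 3 * eps) ^+ 2 = 2 / 3 * eps by rewrite sqr_sqrtr //; lra.
(* The upper bound holds because [2 / 3 * eps < 2 / 9 < 1 / 4]. *)
have heta : 0 < Num.sqrt (2 / 3 * eps) <= 1 / 2.
  have s0 := sqrtr_ge0 (2 / 3 * eps).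
  by apply/andP; split; [rewrite sqrtr_gt0; lra | nra].
have := card_not_embedding W1 d0 r0 rm L0 heta; rewrite eE => h.
apply: le_trans h _; rewrite ler_wpM2l //.
exact: (failure_le hn m0 dn d0 heps hdelta hC hr).
Qed.

Lemma distortion_residual (R : realType) (eps : R) : 0 < eps < 1 / 3 ->
  (1 - 2 / 3 * eps)^-1 <= (1 + 22 * eps) ^+ 2.
Proof.
case/andP => e0 e1; have h : 0 < 1 - 2 / 3 * eps by lra.
rewrite -div1r ler_pdivrMr //.
have -> : (1 + 22 * eps) ^+ 2 * (1 - 2 / 3 * eps)
  = 1 + eps * (44 - 2 / 3 + eps * (484 - 88 / 3 - 968 / 3 * eps)) by field.
rewrite lerDl mulr_ge0 ?ltW // addr_gt0 //; first by lra.
by rewrite mulr_gt0 //; lra.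
Qed.

Lemma distortion_solution (R : realType) (eps : R) : 0 < eps < 1 / 3 ->
  2 / 3 * eps / (1 - 2 / 3 * eps) <= (1 - Num.sqrt eps) / (4 * eps).
Proof.
case/andP => e0 e1; have h : 0 < 1 - 2 / 3 * eps by lra.
rewrite ler_pdivrMr // [leRHS]mulrAC ler_pdivlMr; last by lra.
have s0 := sqrtr_ge0 eps; have sE : Num.sqrt eps ^+ 2 = eps by rewrite sqr_sqrtr // ltW.
set s := Num.sqrt eps in s0 sE *.
(* [578 / 1000] is just above the square root of [1 / 3]. The comparison to be made is then about
   [0.296] against [0.328]. *)
have s1 : s <= 578 / 1000.
  rewrite leNgt; apply/negP => hs; nra.
have q1 : 422 / 1000 * (7 / 9) <= (1 - s) * (1 - 2 / 3 * eps).
  by apply: ler_pM; lra.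
have q2 : eps * eps <= 1 / 3 * (1 / 3) by apply: ler_pM; lra.
lra.
Qed.

Theorem theorem3p1 (R : realType) (p n r : nat)
    (A : 'M[R]_(2 ^ p, n)) (b : 'cV[R]_(2 ^ p)) (eps delta C : R)
    (hn : (0 < n)%N) (hmn : (n <= 2 ^ p)%N) (hA : \rank A = n)
    (heps : 0 < eps < 1 / 3) (hdelta : 0 < delta < 1) (hC : 1 <= C)
    (hr : 6 * C ^+ 2 * eps^-1
          * (Num.sqrt n%:R + Num.sqrt (8 * ln ((2 ^ p)%:R / delta))) ^+ 2
          * ln (n%:R / delta) <= r%:R)
    (hrm : (r <= 2 ^ p)%N) :
  let x_opt := pseudoinverse A *m b in
  let x_tilde := fun w : srht_outcome r (2 ^ p) =>
    pseudoinverse (srht R w *m A) *m (srht R w *m b) in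
  let q := 1 - delta `^ (C ^+ 2 * ln (n%:R / delta) / 4) - 7 * delta in
  q <= srht_prob R (fun w : srht_outcome r (2 ^ p) =>
         norm2 (A *m x_tilde w - b)
           <= (1 + 22 * eps) * norm2 (A *m x_opt - b))
  /\
  (forall (U : 'M[R]_(2 ^ p, n)) (gamma : R),
     left_singular_vectors A U ->
     0 < gamma <= 1 ->
     norm2 (U *m U^T *m b) = gamma * norm2 b ->
     q <= srht_prob R (fun w : srht_outcome r (2 ^ p) =>
            norm2 (x_opt - x_tilde w)
              <= Num.sqrt ((1 - Num.sqrt eps) / (4 * eps)) * cond2 A
                 * Num.sqrt (gamma ^- 2 - 1) * norm2 x_opt)).
Proof.
move=> x_opt x_tilde q.
have pw := powR_ge0 delta (C ^+ 2 * ln (n%:R / delta) / 4).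
case/andP: (hdelta) => dl0 dl1.
(* For [delta >= 1 / 7] the claimed probability is at most zero. The other case gives the lower
   bounds on the logarithms. *)
have [d7|d7] := leP (1 / 7) delta.
  have q0 : q <= 0 by rewrite /q; lra.
  by split=> [|U gamma _ _ _]; exact: le_trans q0 (srht_prob_ge0 _ _).
have hd : 0 < delta < 1 / 7 by rewrite dl0.
have q5 : q <= 1 - 5 * delta by rewrite /q; lra.
have [d [W [TA [tb [W1 AE bE bad]]]]] :=
  exists_srht_embedding b hn hA heps hd hC hr hrm.
case/andP: (heps) => e0 e1.
set eta := Num.sqrt (2 / 3 * eps) in bad.
have eE : eta ^+ 2 = 2 / 3 * eps by rewrite sqr_sqrtr //; lra.
have eta0 : 0 < eta by rewrite sqrtr_gt0; lra.
have eta01 : 0 < eta < 1 by rewrite eta0 /=; nra.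
split=> [|U gamma hU hg hb].
- apply: le_trans q5 (srht_prob_ge hrm _ bad) => w /asboolP iso.
  apply: (sketch_residual_le W1 AE bE eta01 iso); first by lra.
  by rewrite eE; exact: distortion_residual.
- apply: le_trans q5 (srht_prob_ge hrm _ bad) => w /asboolP iso.
  apply: (sketch_solution_le W1 AE bE eta01 iso hA hU hg hb).
  by rewrite eE; exact: distortion_solution.
Qed.
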